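(* For a graph $G$ the following conditions are equivalent: (i) $G$ is a dual polar graph; (ii) $G$ is a thick weakly modular graph not containing induced $K_4^-$ and not containing isometric $K_{3,3}^-$; (iii) $G$ is a thick locally weakly modular graph not containing induced $K_4^-$ and not containing isometric $K_{3,3}^-$, and the triangle-square complex of $G$ is simply connected.
   Context: Graphs are simple, undirected, connected, possibly infinite; $d$ is graph distance, $I(u,v)=\{x:d(u,x)+d(x,v)=d(u,v)\}$. An induced subgraph $H$ is gated if each vertex $x$ has $x'\in H$ with $x'\in I(x,y)$ for all $y\in H$; the gated hull $\langle S\rangle$ of a set $S$ is the smallest gated set containing it. A dual polar graph is a graph satisfying: (A1) every maximal clique is gated; (A3\&4) the gated hull of any two vertices at distance $2$ has diameter $2$; (A5) for every pair of nonadjacent vertices $u,v$ and every neighbor $x$ of $u$ in $I(u,v)$ there exists a neighbor $y$ of $v$ in $I(u,v)$ with $d(u,v)=d(x,y)=d(u,y)+1=d(x,v)+1$ (finite diameter is not required). $G$ is thick if for every pair $u,v$ with $d(u,v)=2$ the interval $I(u,v)$ contains an induced $4$--cycle. Weakly modular: for every vertex $u$, (TC) for $v,w$ with $1=d(v,w)<d(u,v)=d(u,w)$ there is a common neighbor $x$ of $v,w$ with $d(u,x)=d(u,v)-1$, and (QC) for $v,w,z$ with $d(v,z)=d(w,z)=1$, $2=d(v,w)\le d(u,v)=d(u,w)=d(u,z)-1$ there is a common neighbor $x$ of $v,w$ with $d(u,x)=d(u,v)-1$. Locally weakly modular: for every $u$, (LTC) for adjacent $v,w$ with $d(u,v)=d(u,w)=2$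 there is a common neighbor of $u,v,w$, and (LQC) for $v,w,z$ with $z\sim v,w$, $d(v,w)=d(u,v)=d(u,w)=d(u,z)-1=2$ there is a common neighbor of $u,v,w$. $K_4^-$ and $K_{3,3}^-$ denote $K_4$ and $K_{3,3}$ minus one edge; an isometric subgraph is one whose distances agree with those of $G$. The triangle-square complex is the $2$--complex with $1$--skeleton $G$ whose $2$--cells are glued along all $3$--cycles and all induced $4$--cycles. *)

(* Defs.v *)
From Stdlib Require Import List Arith Lia Classical ClassicalEpsilon Relations.
Import ListNotations.

Section G.
Context {V : Type}.
Context (adj : V -> V -> Prop).

Inductive walk : nat -> V -> V -> Prop :=
| walk0 : forall u, walk 0 u u
| walkS : forall n u v w, adj u v -> walk n v w -> walk (S n) u w.

Definition connected : Prop := forall u v : V, exists n, walk n u v.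

Definition is_dist (u v : V) (n : nat) : Prop :=
  walk n u v /\ forall m, m < n -> ~ walk m u v.

(* graph distance d(u,v) (meaningful for connected graphs) *)
Definition d (u v : V) : nat := epsilon (inhabits 0) (is_dist u v).

Definition interval (u v x : V) : Prop := d u x + d x v = d u v.

Definition gated (H : V -> Prop) : Prop :=
  forall x, exists x', H x' /\ forall y, H y -> interval x y x'.

Definition gated_hull (S : V -> Prop) (x : V) : Prop :=
  forall H, gated H -> (forall y, S y -> H y) -> H x.

Definition clique (K : V -> Prop) : Prop :=
  forall x y, K x -> K y -> x <> y -> adj x y.

Definition maximal_clique (K : V -> Prop) : Prop :=
  clique K /\ forall K', clique K' -> (forall x, K x -> K' x) -> forall x, K' x -> K x.

Definition A1 : Prop := forall K, maximal_clique K -> gated K.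

Definition A34 : Prop :=
  forall u v, d u v = 2 ->
    let H := gated_hull (fun x => x = u \/ x = v) in
    (forall x y, H x -> H y -> d x y <= 2) /\ (exists x y, H x /\ H y /\ d x y = 2).

Definition A5 : Prop :=
  forall u v, u <> v -> ~ adj u v ->
    forall x, adj u x -> interval u v x ->
      exists y, adj v y /\ interval u v y /\
        d u v = d x y /\ d x y = d u y + 1 /\ d u y + 1 = d x v + 1.

Definition dual_polar : Prop := A1 /\ A34 /\ A5.

Definition induced_C4 (a b c e : V) : Prop :=
  a <> b /\ a <> c /\ a <> e /\ b <> c /\ b <> e /\ c <> e /\
  adj a b /\ adj b c /\ adj c e /\ adj e a /\ ~ adj a c /\ ~ adj b e.

Definition thick : Prop :=
  forall u v, d u v = 2 ->
    exists a b c e, interval u v a /\ interval u v b /\ interval u v c /\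
      interval u v e /\ induced_C4 a b c e.

Definition TC (u : V) : Prop :=
  forall v w, d v w = 1 -> 1 < d u v -> d u v = d u w ->
    exists x, adj x v /\ adj x w /\ d u x = d u v - 1.

Definition QC (u : V) : Prop :=
  forall v w z, d v z = 1 -> d w z = 1 -> d v w = 2 -> 2 <= d u v ->
    d u v = d u w -> d u w = d u z - 1 ->
    exists x, adj x v /\ adj x w /\ d u x = d u v - 1.

Definition weakly_modular : Prop := forall u, TC u /\ QC u.

Definition LTC (u : V) : Prop :=
  forall v w, adj v w -> d u v = 2 -> d u w = 2 ->
    exists x, adj x u /\ adj x v /\ adj x w.

Definition LQC (u : V) : Prop :=
  forall v w z, adj z v -> adj z w -> d v w = 2 -> d u v = 2 -> d u w = 2 ->
    d u w = d u z - 1 ->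
    exists x, adj x u /\ adj x v /\ adj x w.

Definition locally_weakly_modular : Prop := forall u, LTC u /\ LQC u.

Definition has_induced_K4minus : Prop :=
  exists a b c e,
    a <> b /\ a <> c /\ a <> e /\ b <> c /\ b <> e /\ c <> e /\
    adj a b /\ adj a e /\ adj b c /\ adj c e /\ adj b e /\ ~ adj a c.

Definition has_isometric_K33minus : Prop :=
  exists a1 a2 a3 b1 b2 b3,
    d a1 a2 = 2 /\ d a1 a3 = 2 /\ d a2 a3 = 2 /\
    d b1 b2 = 2 /\ d b1 b3 = 2 /\ d b2 b3 = 2 /\
    d a1 b1 = 3 /\ d a1 b2 = 1 /\ d a1 b3 = 1 /\
    d a2 b1 = 1 /\ d a2 b2 = 1 /\ d a2 b3 = 1 /\
    d a3 b1 = 1 /\ d a3 b2 = 1 /\ d a3 b3 = 1.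

(* Combinatorial fundamental group of the triangle-square complex:
   elementary homotopies of vertex sequences of walks. *)
Inductive elem_htpy : list V -> list V -> Prop :=
| ht_back : forall p q x y, adj x y ->
    elem_htpy (p ++ [x; y; x] ++ q) (p ++ [x] ++ q)
| ht_tri : forall p q x y z, adj x y -> adj y z -> adj z x ->
    elem_htpy (p ++ [x; y; z] ++ q) (p ++ [x; z] ++ q)
| ht_sq : forall p q x y z w, induced_C4 x y z w ->
    elem_htpy (p ++ [x; y; z] ++ q) (p ++ [x; w; z] ++ q).

Definition homotopic : list V -> list V -> Prop :=
  clos_refl_sym_trans (list V) elem_htpy.

Fixpoint is_walk_seq (x : V) (l : list V) : Prop :=
  match l with
  | [] => True
  | y :: l' => adj x y /\ is_walk_seq y l'
  end.

Definition closed_walk (x : V) (l : list V) : Prop :=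
  is_walk_seq x l /\ last l x = x.

Definition tri_sq_simply_connected : Prop :=
  connected /\ forall x l, closed_walk x l -> homotopic (x :: l) [x].

End G.

(* Main.v *)
Require Import Defs.
From Stdlib Require Import List Arith Lia Classical ClassicalEpsilon Relations.
From mathcomp Require classical_sets.
Import ListNotations.

(* Dual polar graphs versus weak modularity: maximal cliques being gated gives the absence of K4 minus an edge and (TC), gated hulls of pairs at distance 2 give (QC) and the absence of isometric K33 minus an edge. Conversely, two lines through [u] spanning a square span a set of diameter 2 closed under common neighbours, and in a weakly modular graph such a set is gated.

Local to global: call a walk reduced if no sequence of square swaps exposes a backtrack or two edges of a triangle. As for words in Coxeter groups, the local conditions show that two reduced walks [z :: w], [z :: w'] that are equivalent under square swaps either have equivalent tails or have tails ending over the two middle corners of a common square. Reduced walks from a base vertex modulo square swaps thus form a covering graph in which triangles and squares lift; if the complex is simply connected the covering is trivial, so reduced walks are geodesics, unique up to square swaps, and (TC), (QC) are read off from the structure of the equivalence. *)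

(** Weak modularity speaks of arbitrarily large distances to a base vertex, while the local
    conditions only see distances up to 3. So the length of a reduced walk stands in for the
    distance until the two are known to agree: from the end of a reduced walk every edge goes down,
    stays level or goes up, and (LTC) and (LQC), centred at a vertex two or three steps below, act
    as (TC) and (QC). Length and distance are identified only at the end, from the triviality of the
    cover. For quads, the obstacle is consistency: a line through [u] should belong to a quad
    whichever opposite point is used to detect this. That independence is what the absence of K33
    minus an edge provides, and it also lets the description of a quad be moved from one of its
    points to another. *)

Section Graph.
Context {V : Type} {adj : V -> V -> Prop}.
Hypothesis Hsym : forall x y, adj x y -> adj y x.
Hypothesis Hirr : forall x, ~ adj x x.
Hypothesis Hconn : connected adj.
Local Notation d := (d adj).
Hint Immediate Hsym : core.

(** * Graph distance *)

Lemma d_spec u v : is_dist adj u v (d u v).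
Proof.
  unfold Defs.d. apply epsilon_spec.
  destruct (Hconn u v) as [n Hn]. revert Hn.
  induction n as [n IH] using (well_founded_induction lt_wf). intros Hn.
  destruct (classic (exists m, m < n /\ walk adj m u v)) as [[m [H1 H2]]|H].
  - eauto.
  - exists n. split; auto. intros m Hm Hw. apply H. eauto.
Qed.

Lemma d_walk u v : walk adj (d u v) u v.
Proof. apply d_spec. Qed.

Lemma d_le n u v : walk adj n u v -> d u v <= n.
Proof.
  intros H. destruct (d_spec u v) as [_ H2].
  destruct (le_lt_dec (d u v) n); auto. destruct (H2 n); auto.
Qed.

Lemma walk_app n m u v w : walk adj n u v -> walk adj m v w -> walk adj (n + m) u w.
Proof. induction 1; simpl; auto. intros. econstructor; eauto. Qed.

Lemma walk_rev n u v : walk adj n u v -> walk adj n v u.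
Proof.
  induction 1. constructor.
  replace (S n) with (n + 1) by lia. eapply walk_app; eauto.
  econstructor. apply Hsym; eauto. constructor.
Qed.

Lemma d_sym u v : d u v = d v u.
Proof. apply Nat.le_antisymm; apply d_le, walk_rev, d_walk. Qed.

Lemma d_tri u v w : d u w <= d u v + d v w.
Proof. apply d_le. eapply walk_app; apply d_walk. Qed.

Lemma d_refl u : d u u = 0.
Proof. assert (d u u <= 0) by (apply d_le; constructor). lia. Qed.

Lemma d_zero u v : d u v = 0 -> u = v.
Proof. intros H. pose proof (d_walk u v) as W. rewrite H in W. inversion W; auto. Qed.

Lemma d_adj u v : adj u v -> d u v = 1.
Proof.
  intros H. assert (d u v <= 1) by (apply d_le; econstructor; eauto; constructor).
  destruct (d u v) as [|[|]] eqn:E; try lia. apply d_zero in E; subst. destruct (Hirr _ H).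
Qed.

Lemma d_one u v : d u v = 1 -> adj u v.
Proof.
  intros H. pose proof (d_walk u v) as W. rewrite H in W.
  inversion W; subst. inversion H2; subst; auto.
Qed.

Lemma d_succ u v n : d u v = S n -> exists x, adj u x /\ d x v = n.
Proof.
  intros H. pose proof (d_walk u v) as W. rewrite H in W.
  inversion W; subst. exists v0; split; auto.
  apply d_le in H2. pose proof (d_tri u v0 v). rewrite (d_adj _ _ H1) in H0. lia.
Qed.

(** Distance 2 in terms of adjacency alone, so that it can be established by automation without
    arithmetic. *)
Definition far2 (u v : V) : Prop :=
  u <> v /\ ~ adj u v /\ exists c, adj u c /\ adj c v.

Lemma d_two u v : d u v = 2 <-> far2 u v.
Proof.
  split.
  - intros H. repeat split.
    + intros ->. rewrite d_refl in H. lia.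
    + intros A. rewrite (d_adj _ _ A) in H. lia.
    + destruct (d_succ _ _ _ H) as [c [A B]]. exists c. split; auto. apply d_one; auto.
  - intros (A & B & c & C & D). pose proof (d_tri u c v).
    rewrite (d_adj _ _ C), (d_adj _ _ D) in H.
    destruct (d u v) as [|[|]] eqn:E; try lia.
    + apply d_zero in E; tauto.
    + apply d_one in E; tauto.
Qed.

Lemma d_adj_bounds u x y : adj x y -> d u x <= d u y + 1 /\ d u y <= d u x + 1.
Proof.
  intros A. pose proof (d_tri u x y); pose proof (d_tri u y x).
  rewrite (d_adj x y A) in *. rewrite (d_adj y x (Hsym _ _ A)) in *. lia.
Qed.

Definition diamond_free : Prop := forall a b x y,
  adj x y -> adj a x -> adj a y -> adj b x -> adj b y -> a = b \/ adj a b.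

Lemma diamond_free_iff : diamond_free <-> ~ has_induced_K4minus adj.
Proof.
  split.
  - intros D (a & x & b & y & N1 & N2 & N3 & N4 & N5 & N6 & A1 & A2 & A3 & A4 & A5 & A6).
    destruct (D a b x y); auto.
  - intros N a b x y A1 A2 A3 A4 A5.
    destruct (classic (a = b)) as [|Nab]; auto. destruct (classic (adj a b)) as [|Aab]; auto.
    assert (X : forall u v, adj u v -> u <> v) by (intros u v A ->; exact (Hirr _ A)).
    exfalso. apply N. exists a, x, b, y. repeat split; auto.
Qed.

(** * Maximal cliques, gated sets and consequences of the axioms *)

Lemma argmax (P : V -> Prop) (f : V -> nat) N : (exists x, P x) -> (forall x, P x -> f x <= N) ->
  exists x, P x /\ forall y, P y -> f y <= f x.
Proof.
  intros [x0 H0] HN. remember (N - f x0) as k eqn:Hk. revert x0 H0 Hk.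
  induction k as [k IH] using (well_founded_induction lt_wf). intros x0 H0 Hk.
  destruct (classic (exists y, P y /\ f x0 < f y)) as [[y [H1 H2]]|H].
  - pose proof (HN _ H1). apply (IH (N - f y) ltac:(lia) y); auto.
  - exists x0. split; auto. intros y Hy. destruct (le_lt_dec (f y) (f x0)); auto.
    exfalso; eauto.
Qed.

Lemma argmin (P : V -> Prop) (f : V -> nat) : (exists x, P x) ->
  exists x, P x /\ forall y, P y -> f x <= f y.
Proof.
  intros [x0 H0]. remember (f x0) as k eqn:Hk. revert x0 H0 Hk.
  induction k as [k IH] using (well_founded_induction lt_wf). intros x0 H0 Hk.
  destruct (classic (exists y, P y /\ f y < f x0)) as [[y [H1 H2]]|H].
  - apply (IH (f y) ltac:(lia) y); auto.
  - exists x0. split; auto. intros y Hy. destruct (le_lt_dec (f x0) (f y)); auto.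
    exfalso; eauto.
Qed.

Lemma clique_extend K : clique adj K ->
  exists M, maximal_clique adj M /\ forall x, K x -> M x.
Proof.
  intros HK.
  (* The chains of Zorn's lemma include the empty one, whose union is empty. Asking that the union
     of [A] and [K] be a clique, rather than that [A] contain [K], covers this case. *)
  destruct (classical_sets.Zorn_bigcup (T := V) (P := fun A => clique adj (fun x => A x \/ K x)))
    as [A [HA Hmax]].
  - intros F HF Htot x y Hx Hy Nxy.
    destruct Hx as [[X FX Hx]|Hx], Hy as [[Y FY Hy]|Hy].
    + destruct (Htot X Y FX FY) as [S|S].
      * apply (HF Y FY x y); auto; left; apply S; auto.
      * apply (HF X FX x y); auto; left; apply S; auto.
    + apply (HF X FX x y); auto.
    + apply (HF Y FY x y); auto.
    + apply HK; auto.
  - exists (fun x => A x \/ K x). split; [split|]; auto.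
    intros K' HK' Hsub x Hx. apply NNPP; intros Nx.
    apply (Hmax K').
    + split; [intros y Hy; apply Hsub; auto|]. intros S. apply Nx. left; apply S; auto.
    + intros y z Hy Hz. apply HK'; destruct Hy, Hz; auto.
Qed.

(** A gate of [c] other than [c] would be at distance 0 from both [x] and [y]. *)
Lemma gated_common (H : V -> Prop) x y c : gated adj H -> H x -> H y -> x <> y ->
  adj c x -> adj c y -> H c.
Proof.
  intros G Hx Hy N A B. destruct (G c) as (c' & Hc & I).
  pose proof (I _ Hx) as Ix. pose proof (I _ Hy) as Iy. unfold interval in *.
  rewrite (d_adj _ _ A) in Ix. rewrite (d_adj _ _ B) in Iy.
  destruct (d c c') eqn:E1.
  - apply d_zero in E1; subst; auto.
  - exfalso. apply N. rewrite <- (d_zero c' x), <- (d_zero c' y); auto; lia.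
Qed.

Lemma A1_diamond_free : A1 adj -> diamond_free.
Proof.
  intros HA a b x y Axy Aax Aay Abx Aby.
  destruct (clique_extend (fun z => z = x \/ z = y \/ z = a)) as (M & [MC MM] & Msub).
  { intros u v [-> | [-> | -> ]] [-> | [-> | -> ]] N; auto; congruence. }
  assert (G : gated adj M) by (apply HA; split; auto).
  assert (Hb : M b).
  { apply (gated_common M x y); auto. intros ->; exact (Hirr _ Axy). }
  destruct (classic (a = b)); [left|right; apply MC]; auto.
Qed.

(** The gate of [u] in a maximal clique through [v] and [w] is neither of the two, since they are
    equally far from [u]; it is the vertex sought. *)
Lemma A1_TC : A1 adj -> forall u, TC adj u.
Proof.
  intros HA u v w Hvw Hv Hd. pose proof (d_one _ _ Hvw) as A.
  destruct (clique_extend (fun z => z = v \/ z = w)) as (M & [MC MM] & Msub).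
  { intros a b [-> | -> ] [-> | -> ] N; auto; congruence. }
  assert (G : gated adj M) by (apply HA; split; auto).
  destruct (G u) as (x & Mx & I).
  assert (Iv := I v (Msub v ltac:(auto))). assert (Iw := I w (Msub w ltac:(auto))).
  unfold interval in *.
  assert (Nv : x <> v). { intros ->. rewrite d_refl in *. lia. }
  assert (Nw : x <> w). { intros ->. rewrite d_refl in *. rewrite (d_sym w v) in *. lia. }
  exists x. assert (Av : adj x v) by (apply MC; auto). assert (Aw : adj x w) by (apply MC; auto).
  rewrite (d_adj _ _ Av) in *. repeat split; auto. lia.
Qed.

(* The gate of [x] is a point lying in all the intervals from [x] to the hull and farthest from [x] among these: projecting it further into a gated superset cannot move it. *)
Lemma gated_hull_gated (S : V -> Prop) p : S p -> gated adj (gated_hull adj S).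
Proof.
  intros Sp x. assert (Hp : gated_hull adj S p) by (intros H _ HS; auto).
  destruct (argmax (fun g => forall y, gated_hull adj S y -> interval adj x y g) (d x) (d x p))
    as (g & Pg & Mg).
  { exists x. intros y _. unfold interval. rewrite d_refl. reflexivity. }
  { intros g Pg. specialize (Pg p Hp). unfold interval in Pg. lia. }
  exists g. split; auto. intros H GH HS.
  destruct (GH g) as (h & Hh & I).
  assert (X : forall y, gated_hull adj S y -> d x h + d h y = d x y /\ d x h = d x g + d g h).
  { intros y Hy. specialize (I y (Hy H GH HS)). specialize (Pg y Hy). unfold interval in *.
    pose proof (d_tri x g h). pose proof (d_tri x h y). lia. }
  assert (d x h <= d x g) by (apply Mg; intros y Hy; apply X; auto).
  destruct (X p Hp). replace g with h; auto. symmetry. apply d_zero. lia.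
Qed.

Definition quad (u v : V) : V -> Prop := gated_hull adj (fun x => x = u \/ x = v).

Lemma quad_l u v : quad u v u.
Proof. intros H _ HS; auto. Qed.

Lemma quad_r u v : quad u v v.
Proof. intros H _ HS; auto. Qed.

Lemma quad_gated u v : gated adj (quad u v).
Proof. apply (gated_hull_gated _ u); auto. Qed.

(** The vertex sought is the gate of [u] in the hull of [v] and [w]. The hull contains [z] and has
    diameter 2, so the gate is at most two levels below [z]; it is not [v], because [w] is equally
    far from [u]. *)
Lemma A34_QC : A34 adj -> forall u, QC adj u.
Proof.
  intros HA u v w z Hvz Hwz Hvw Hv Hd Hz.
  apply d_one in Hvz, Hwz. assert (N : v <> w). { intros ->. rewrite d_refl in Hvw; lia. }
  destruct (HA v w Hvw) as [D _]. change (gated_hull adj (fun x => x = v \/ x = w)) with (quad v w) in D.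
  assert (Qz : quad v w z).
  { apply (gated_common _ v w); auto using quad_gated, quad_l, quad_r. }
  destruct (quad_gated v w u) as (x & Qx & I).
  pose proof (I z Qz) as Iz. pose proof (I v (quad_l _ _)) as Iv. pose proof (I w (quad_r _ _)) as Iw.
  unfold interval in *. pose proof (D x z Qx Qz).
  assert (X : d x v <> 0). { intros E. pose proof (d_zero _ _ E); subst. lia. }
  exists x. repeat split; try apply d_one; lia.
Qed.

(** The hull of [a2] and [a3] absorbs [b1], [b2], [b3], then [a1] as a common neighbour of [b2] and
    [b3]; but [a1] and [b1] are at distance 3. *)
Lemma A34_no_K33minus : A34 adj -> ~ has_isometric_K33minus adj.
Proof.
  intros HA (a1 & a2 & a3 & b1 & b2 & b3 & A12 & A13 & A23 & B12 & B13 & B23 &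
    E11 & E12 & E13 & E21 & E22 & E23 & E31 & E32 & E33).
  apply d_one in E12, E13, E21, E22, E23, E31, E32, E33.
  destruct (HA a2 a3 A23) as [D _]. change (gated_hull adj (fun x => x = a2 \/ x = a3)) with (quad a2 a3) in D.
  assert (X : forall x y, d x y = 2 -> x <> y). { intros x y E ->. rewrite d_refl in E; lia. }
  assert (Q : forall b, adj a2 b -> adj a3 b -> quad a2 a3 b).
  { intros b ? ?. apply (gated_common _ a2 a3); auto using quad_gated, quad_l, quad_r. }
  assert (Qa : quad a2 a3 a1).
  { apply (gated_common _ b2 b3); auto using quad_gated. }
  pose proof (D a1 b1 Qa (Q b1 E21 E31)). lia.
Qed.

Lemma A5_thick : A5 adj -> thick adj.
Proof.
  intros HA u v Huv. destruct (proj1 (d_two u v) Huv) as (N & A & x & Aux & Axv).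
  destruct (HA u v N A x Aux) as (y & Avy & Iy & E1 & E2 & E3).
  { unfold interval. rewrite (d_adj _ _ Aux), (d_adj _ _ Axv). auto. }
  assert (Auy : adj u y) by (apply d_one; lia).
  destruct (proj1 (d_two x y)) as (N' & A' & _); [lia|].
  exists u, x, v, y. unfold interval.
  assert (X : forall a b, adj a b -> a <> b) by (intros a b B ->; exact (Hirr _ B)).
  rewrite !d_refl, (d_adj _ _ Aux), (d_adj _ _ Axv), (d_adj _ _ Auy), (d_adj _ _ (Hsym _ _ Avy)).
  repeat split; auto; lia.
Qed.

Definition triangle_local : Prop := forall u v w, adj v w -> far2 u v -> far2 u w ->
  exists x, adj x u /\ adj x v /\ adj x w.

Lemma far2_sym u v : far2 u v -> far2 v u.
Proof. intros (N & A & c & B & C). repeat split; auto. exists c; auto. Qed.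

Lemma LTC_triangle_local : (forall u, LTC adj u) <-> triangle_local.
Proof.
  split; intros H u v w A Hv Hw; apply d_two in Hv, Hw; apply (H u v w); auto.
Qed.

Lemma TC_triangle_local : (forall u, TC adj u) -> triangle_local.
Proof.
  intros H u v w A Hv Hw. apply d_two in Hv, Hw.
  destruct (H u v w) as (x & B & C & D); [apply d_adj; auto|lia|lia|].
  exists x. repeat split; auto. apply Hsym, d_one. lia.
Qed.

(** * Quads *)

Section Quads.
Hypothesis Hdia : diamond_free.
Hypothesis Hltc : triangle_local.
Hypothesis HK33 : ~ has_isometric_K33minus adj.

(** By [diamond_free] this relation is transitive among the neighbours of a vertex [u]; its classes
    there are the lines through [u], with [u] removed. *)
Definition col (a b : V) : Prop := a = b \/ adj a b.

Lemma col_sym a b : col a b -> col b a.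
Proof. intros [->|A]; [left|right]; auto. Qed.

Lemma col_trans u a b c : adj u a -> adj u b -> adj u c -> col a b -> col b c -> col a c.
Proof.
  intros A B C [->|D]; auto. intros [<-|F]; [right; auto|].
  apply (Hdia a c u b); auto.
Qed.

(* [x] is adjacent to a point, other than [u], of the line through [u] and [y]. *)
Definition near (u y x : V) : Prop := exists n, adj u n /\ col n y /\ adj n x.

Lemma near_col u n y x : adj u n -> adj u y -> col n y -> near u n x -> near u y x.
Proof.
  intros A B C (m & D & F & G). exists m. repeat split; auto.
  apply (col_trans u m n y); auto.
Qed.

Lemma near_refl u y x : adj u y -> adj y x -> near u y x.
Proof. intros A B. exists y. repeat split; auto. left; auto. Qed.

(** The vertex [c] keeps [x] within distance 2 of [y]. If they are not adjacent, [x] is at distance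
    2 from both ends of the edge from [u] to [y], and (LTC) gives a point of that line adjacent to
    [x]. *)
Lemma near_of_common u y x c : far2 u x -> adj u y -> adj c x -> col c y -> near u y x.
Proof.
  intros F A B C. destruct (classic (adj y x)) as [D|D]; [apply near_refl; auto|].
  destruct C as [->|C]; [tauto|].
  destruct (Hltc x u y) as (n & N1 & N2 & N3); auto using far2_sym.
  - repeat split; [intros ->; destruct F as (_ & K & _); auto|auto|exists c; auto].
  - exists n. repeat split; auto. right; auto.
Qed.

Lemma near_common u y x c : far2 u x -> adj u y -> adj c x -> adj c y -> near u y x.
Proof. intros. apply (near_of_common u y x c); auto. right; auto. Qed.

Lemma far2_no_diamond u x p q : far2 u x -> adj u p -> adj u q -> adj x p -> adj x q -> ~ adj p q.
Proof.
  intros (N & A & _) B C D F G. destruct (Hdia u x p q); auto.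
Qed.

(** If [x'] and [y] were at distance 3, the parts [x'], [u], [x] and [y], [p1], [p2] would form an
    isometric K33 minus an edge. At distance 2, (LTC) gives the claim. *)
Lemma near_share u p1 p2 x x' y : adj u p1 -> adj u p2 -> ~ col p1 p2 -> far2 u x -> far2 u x' ->
  adj x p1 -> adj x p2 -> adj x' p1 -> adj x' p2 -> adj y u -> adj y x -> near u y x'.
Proof.
  intros A1 A2 Np Fx Fx' B1 B2 B1' B2' Ayu Ayx.
  destruct (classic (y = p1)) as [->|N1]; [apply near_refl; auto|].
  destruct (classic (y = p2)) as [->|N2]; [apply near_refl; auto|].
  destruct (classic (x = x')) as [<-|Nx]; [apply near_refl; auto|].
  assert (Ax : ~ adj x x').
  { intros C. destruct (Hdia p1 p2 x x'); auto; apply Np; [left|right]; auto. }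
  assert (C1 : ~ adj y p1) by (apply (far2_no_diamond u x); auto).
  assert (C2 : ~ adj y p2) by (apply (far2_no_diamond u x); auto).
  assert (C3 : ~ adj p1 p2) by (apply (far2_no_diamond u x); auto).
  destruct (le_lt_dec (d x' y) 2) as [H|H].
  - destruct (d x' y) as [|[|[|]]] eqn:D; try lia.
    + apply d_zero in D; subst. destruct Fx' as (_ & K & _). exfalso; auto.
    + apply d_one in D. apply near_refl; auto.
    + apply d_two in D. destruct D as (_ & _ & c & D1 & D2).
      apply (near_common u y x' c); auto.
  - exfalso. apply HK33. exists x', u, x, y, p1, p2.
    assert (d x' y = 3).
    { pose proof (d_tri x' p1 y). pose proof (d_tri p1 u y).
      rewrite (d_adj _ _ B1'), (d_adj p1 u (Hsym _ _ A1)), (d_adj u y (Hsym _ _ Ayu)) in *. lia. }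
    repeat split; auto; try (apply d_adj; auto); apply d_two; auto using far2_sym;
      repeat split; auto; eauto.
    intros K; apply Np; left; auto.
Qed.

(** Slides the projection [p] of [x] along its line to [p'], keeping the projection [q]: (LTC) for
    [p'] and the edge from [x] to [q] gives [m]. As [m] is adjacent to [x], it stays near every line
    that [x] is near. *)
Lemma near_step u p q p' x y : far2 u x -> adj u p -> adj u q -> adj u p' -> adj u y ->
  ~ col p q -> adj x p -> adj x q -> col p p' -> near u y x ->
  exists m, far2 u m /\ adj m p' /\ adj m q /\ near u y m.
Proof.
  intros Fx Ap Aq Ap' Ay Npq Bp Bq [<-|Cpp] (n & N1 & N2 & N3).
  { exists x. repeat split; auto; try apply Fx. exists n; auto. }
  assert (C1 : ~ adj x p'). { intros C. apply (far2_no_diamond u x p p'); auto. }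
  assert (C2 : ~ col p' q).
  { intros C. apply Npq. apply (col_trans u p p' q); auto. right; auto. }
  destruct (Hltc p' x q) as (m & M1 & M2 & M3); auto.
  { repeat split; [intros ->; destruct Fx as (_ & K & _); auto|auto|exists p; auto]. }
  { repeat split; [intros ->; apply C2; left; auto|intros K; apply C2; right; auto|exists u; auto]. }
  assert (Fm : far2 u m).
  { repeat split; [intros ->; destruct Fx as (_ & K & _); auto| |exists p'; auto].
    intros K. apply (far2_no_diamond u x m q); auto. }
  exists m. repeat split; auto; try apply Fm.
  apply (near_col u n y m); auto. apply (near_common u n m x); auto.
Qed.

Lemma col_apart u a b p q : adj u a -> adj u b -> adj u p -> adj u q -> ~ col a b ->
  col p a -> col q b -> ~ col p q.
Proof.
  intros A B P Q N C D K. apply N. apply (col_trans u a p b); auto using col_sym.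
  apply (col_trans u p q b); auto.
Qed.

(** The points at distance 2 from [u] in the quad spanned by the lines from [u] through [a] and [b]:
    those that project to both lines. *)
Definition opp (u a b x : V) : Prop := far2 u x /\ near u a x /\ near u b x.

(* Move the two projections of [x] along their lines until they are those of [x'], then use the absence of K33 minus an edge. *)
Lemma opp_near u a b x x' y : adj u a -> adj u b -> ~ col a b -> opp u a b x -> opp u a b x' ->
  adj u y -> near u y x -> near u y x'.
Proof.
  intros Aa Ab Nab (Fx & (p1 & P1 & P2 & P3) & (p2 & Q1 & Q2 & Q3))
    (Fx' & (p1' & P1' & P2' & P3') & (p2' & Q1' & Q2' & Q3')) Ay Ny.
  destruct (near_step u p1 p2 p1' x y) as (m & Fm & M1 & M2 & Nm); auto.
  { apply (col_apart u a b); auto. }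
  { apply (col_trans u p1 a p1'); auto using col_sym. }
  destruct (near_step u p2 p1' p2' m y) as (m' & Fm' & M1' & M2' & (n & N1 & N2 & N3)); auto.
  { apply (col_apart u b a); auto using col_sym. }
  { apply (col_trans u p2 b p2'); auto using col_sym. }
  apply (near_col u n y x'); auto.
  apply (near_share u p1' p2' m' x' n); auto. apply (col_apart u a b); auto.
Qed.

Definition side (u a b y : V) : Prop := adj u y /\ exists z, opp u a b z /\ near u y z.

(** The quad layered by distance 0, 1, 2 from [u]. *)
Definition quad_set (u a b x : V) : Prop := x = u \/ side u a b x \/ opp u a b x.

Section OneQuad.
Context (u a b : V) (Ha : adj u a) (Hb : adj u b) (Hab : ~ col a b).

Lemma side_opp y x : side u a b y -> opp u a b x -> near u y x.
Proof. intros [A (z & Hz & Nz)] Hx. apply (opp_near u a b z x y); auto. Qed.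

Lemma side_col y y' : side u a b y -> adj u y' -> col y y' -> side u a b y'.
Proof.
  intros [A (z & Hz & Nz)] A' C. split; auto. exists z; split; auto.
  apply (near_col u y y'); auto.
Qed.

Lemma opp_side y x : opp u a b x -> adj u y -> adj y x -> side u a b y.
Proof. intros H A B. split; auto. exists x; split; auto using near_refl. Qed.

Lemma opp_adj y c : opp u a b y -> adj c y -> far2 u c -> opp u a b c.
Proof.
  assert (K : forall l, adj u l -> near u l y -> adj c y -> far2 u c -> near u l c).
  { intros l A (n & N1 & N2 & N3) C F. apply (near_col u n l c); auto.
    apply (near_common u n c y); auto. }
  intros (F & N1 & N2) A F'. split; [|split]; auto.
Qed.

(** Any two distinct lines through [u] in the quad span it again: a point [z] opposite for the old
    pair is opposite for the new one, so [opp_near] transfers both old projections from [z] to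
    [c]. *)
Lemma opp_rebase y1 y2 c : side u a b y1 -> side u a b y2 -> ~ col y1 y2 -> opp u y1 y2 c -> opp u a b c.
Proof.
  intros S1 S2 N Hc. pose proof S1 as (A1 & z & Hz & _). pose proof S2 as (A2 & _).
  assert (Hz' : opp u y1 y2 z).
  { split; [apply Hz|split]; apply side_opp; auto. }
  split; [apply Hc|]. destruct Hz as (_ & Na & Nb).
  split; apply (opp_near u y1 y2 z c); auto.
Qed.

(** Change the viewpoint from [u] to the projection [p] of [x]. Both [p2] and [y] are opposite to
    [p] in the quad of the lines from [p] through [p'] and [n]. The line from [p] through [x] is
    near [p2], hence near [y]. *)
Lemma opp_opp x y : opp u a b x -> opp u a b y -> d x y <= 2.
Proof.
  assert (K2 : forall x y z, adj z x -> col z y -> d x y <= 2).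
  { intros p q r A C. pose proof (d_tri p r q). rewrite (d_adj p r (Hsym _ _ A)) in H.
    destruct C as [->|C]; [rewrite d_refl in H|rewrite (d_adj _ _ C) in H]; lia. }
  intros (Fx & (p & P1 & P2 & P3) & (p2 & Q1 & Q2 & Q3))
    (Fy & (p' & P1' & P2' & P3') & (p2' & Q1' & Q2' & Q3')).
  destruct (classic (adj p y)) as [A|Apy]; [apply (K2 x y p); auto; right; auto|].
  assert (Cp : col p p') by (apply (col_trans u p a p'); auto using col_sym).
  destruct Cp as [->|Cp]; [tauto|].
  assert (N1 : ~ col p p2) by (apply (col_apart u a b); auto).
  assert (N2 : ~ col p p2') by (apply (col_apart u a b); auto).
  assert (N3 : ~ col p' p2') by (apply (col_apart u a b); auto).
  assert (Fpy : far2 p y).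
  { repeat split; [intros ->; destruct Fy as (_ & K & _); auto|auto|exists p'; auto]. }
  assert (Fp : forall q, adj u q -> ~ col p q -> far2 p q).
  { intros q A N. repeat split; [intros ->; apply N; left; auto|intros K; apply N; right; auto|exists u; auto]. }
  destruct (Hltc p y p2') as (n & M1 & M2 & M3); auto.
  assert (Nun : ~ adj u n).
  { intros K. apply (far2_no_diamond u y n p2'); auto. }
  assert (Npn : ~ col p' n).
  { intros [->|K]; [auto|]. apply (far2_no_diamond p y p' n); auto. }
  assert (H : near p x y).
  { apply (opp_near p p' n p2 y x); auto.
    - repeat split; try apply Fp; auto.
      + exists u. repeat split; auto. right; auto.
      + assert (C : col p2 p2') by (apply (col_trans u p2 b p2'); auto using col_sym).
        destruct C as [->|C]; [apply near_refl; auto|].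
        apply (near_common p n p2 p2'); auto.
    - repeat split; try apply Fpy; apply near_refl; auto.
    - apply near_refl; auto. }
  destruct H as (n' & H1 & H2 & H3). rewrite d_sym. apply (K2 y x n'); auto.
Qed.

Lemma quad_set_diam x y : quad_set u a b x -> quad_set u a b y -> d x y <= 2.
Proof.
  assert (K : forall x y, side u a b y -> opp u a b x -> d x y <= 2).
  { intros p q S O. destruct (side_opp q p S O) as (n & N1 & N2 & N3).
    pose proof (d_tri p n q) as T. rewrite (d_adj p n (Hsym _ _ N3)) in T.
    destruct N2 as [->|C]; [rewrite d_refl in T|rewrite (d_adj _ _ C) in T]; lia. }
  assert (D2 : forall q, opp u a b q -> d u q = 2) by (intros q (F & _); apply d_two; auto).
  intros [->|[Sx|Ox]] [->|[Sy|Oy]].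
  - rewrite d_refl; lia.
  - rewrite (d_adj _ _ (proj1 Sy)); lia.
  - rewrite D2; auto.
  - rewrite (d_adj _ _ (Hsym _ _ (proj1 Sx))); lia.
  - pose proof (d_tri x u y) as T. rewrite (d_adj _ _ (Hsym _ _ (proj1 Sx))), (d_adj _ _ (proj1 Sy)) in T. lia.
  - rewrite d_sym; auto.
  - rewrite d_sym, D2; auto.
  - auto.
  - apply opp_opp; auto.
Qed.

Lemma quad_set_closed x y c : QC adj u -> quad_set u a b x -> quad_set u a b y -> x <> y ->
  adj c x -> adj c y -> quad_set u a b c.
Proof.
  intros Hqc Qx Qy Nxy Acx Acy.
  destruct (classic (c = u)) as [->|Ncu]; [left; auto|].
  destruct (classic (adj u c)) as [Auc|Auc].
  { right; left.
    assert (K : forall z, quad_set u a b z -> z <> u -> adj c z -> side u a b c).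
    { intros z [->|[S|O]] N A; [congruence| |apply (opp_side c z); auto].
      apply (side_col z c); auto. right; auto. }
    destruct (classic (x = u)) as [->|N]; [apply (K y)|apply (K x)]; auto. }
  assert (K : forall z, quad_set u a b z -> adj c z -> side u a b z \/ opp u a b z).
  { intros z [->|[S|O]] A; auto. exfalso; auto. }
  assert (F : forall z, side u a b z -> adj c z -> far2 u c).
  { intros z [S _] A. repeat split; auto. exists z; auto. }
  destruct (classic (far2 u c)) as [Fc|Fc].
  { right; right. destruct (K x Qx Acx) as [Sx|Ox]; [|apply (opp_adj x c); auto].
    destruct (K y Qy Acy) as [Sy|Oy]; [|apply (opp_adj y c); auto].
    apply (opp_rebase x y c); auto.
    - intros [->|A]; [congruence|]. apply (far2_no_diamond u c x y); auto; [apply Sx|apply Sy].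
    - split; auto. split; apply near_refl; auto; [apply Sx|apply Sy]. }
  exfalso.
  destruct (K x Qx Acx) as [Sx|Ox]; [apply Fc, (F x); auto|].
  destruct (K y Qy Acy) as [Sy|Oy]; [apply Fc, (F y); auto|].
  pose proof (proj1 Ox) as Fx. pose proof (proj1 Oy) as Fy.
  assert (Axy : ~ adj x y).
  (* Otherwise (LTC) gives a neighbour [m] of [u] on the line of [x] and [y], which also contains
     [c]. *)
  { intros A. destruct (Hltc u x y) as (m & M1 & M2 & M3); auto.
    destruct (Hdia c m x y) as [->|B]; auto.
    apply Fc. repeat split; auto. exists m; auto. }
  assert (Fxy : far2 x y) by (repeat split; auto; exists c; auto).
  assert (Dx : d u x = 2) by (apply d_two; auto). assert (Dy : d u y = 2) by (apply d_two; auto).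
  assert (Dc : d u c = 3).
  { pose proof (d_tri u x c) as T. rewrite (d_adj x c (Hsym _ _ Acx)) in T.
    destruct (d u c) as [|[|[|[|]]]] eqn:E; try lia.
    - apply d_zero in E; congruence.
    - apply d_one in E; tauto.
    - apply d_two in E; tauto. }
  destruct (Hqc x y c) as (m & M1 & M2 & M3); try lia; try (apply d_adj; auto).
  { apply d_two; auto. }
  assert (Aum : adj u m) by (apply d_one; lia). clear M3.
  assert (P : exists p, adj u p /\ adj p x /\ ~ col m p).
  { destruct Ox as (_ & (p1 & P1 & P2 & P3) & (p2 & Q1 & Q2 & Q3)).
    destruct (classic (col m p1)) as [C|C]; [|exists p1; auto].
    exists p2. repeat split; auto. intros C'.
    apply (col_apart u a b p1 p2); auto. apply (col_trans u p1 m p2); auto using col_sym. }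
  destruct P as (p & P1 & P2 & P3).
  destruct (side_opp p y (opp_side p x Ox P1 P2) Oy) as (p' & R1 & R2 & R3).
  (* Seen from [x], both [y] and [u] are opposite in the quad of the lines through [m] and [p]. The
     line from [x] through [c] is near [y], hence near [u], which puts [c] within distance 2 of
     [u]. *)
  destruct (opp_near x m p y u c) as (n & N1 & N2 & N3); auto.
  - split; auto. split; [apply near_refl; auto|].
    apply (near_of_common x p y p'); auto.
  - split; [apply far2_sym; auto|]. split; apply near_refl; auto.
  - apply near_refl; auto.
  - destruct N2 as [->|C]; [auto|]. apply Fc. repeat split; auto. exists n; auto.
Qed.
End OneQuad.
End Quads.

(** * From weak modularity back to the axioms *)

(** Let [h] be nearest to [x] in [H]. A second point of [H] on the same level would share with [h],
    by (TC) or (QC), a neighbour nearer to [x], and closure puts this neighbour in [H]. *)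
Lemma closed_gated (H : V -> Prop) : weakly_modular adj -> (exists x, H x) ->
  (forall x y, H x -> H y -> d x y <= 2) ->
  (forall x y c, H x -> H y -> x <> y -> adj c x -> adj c y -> H c) -> gated adj H.
Proof.
  intros WM NE D C x.
  destruct (argmin H (d x) NE) as (h & Hh & Mh).
  exists h. split; auto. intros y Hy. unfold interval.
  assert (N1 : forall z, H z -> adj h z -> d x z = d x h + 1).
  { intros z Hz A. pose proof (d_adj_bounds x h z A). pose proof (Mh z Hz).
    destruct (Nat.eq_dec (d x z) (d x h)) as [E|]; [|lia]. exfalso.
    assert (Nhz : h <> z) by (intros ->; exact (Hirr _ A)).
    destruct (d x h) as [|[|k]] eqn:Ek.
    - apply d_zero in E, Ek. congruence.
    (* (TC) only starts at distance 2; at distance 1 the vertex [x] itself is the common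
       neighbour. *)
    - apply d_one in E, Ek. pose proof (Mh x (C h z x Hh Hz Nhz Ek E)). rewrite d_refl in *. lia.
    - destruct (proj1 (WM x) h z) as (m & M1 & M2 & M3); try lia; [apply d_adj; auto|].
      pose proof (Mh m (C h z m Hh Hz Nhz M1 M2)). lia. }
  assert (N2 : forall z, H z -> far2 h z -> d x z <> d x h).
  { intros z Hz (N & A & c & C1 & C2) E.
    assert (Hc : H c) by (apply (C h z c); auto).
    pose proof (N1 c Hc C1).
    destruct (d x h) as [|[|k]] eqn:Ek.
    - apply d_zero in E, Ek. congruence.
    - apply d_one in E, Ek. pose proof (Mh x (C h z x Hh Hz N Ek E)). rewrite d_refl in *. lia.
    - destruct (proj2 (WM x) h z c) as (m & M1 & M2 & M3); try lia; try (apply d_adj; auto).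
      + apply d_two. repeat split; auto. exists c; auto.
      + pose proof (Mh m (C h z m Hh Hz N M1 M2)). lia. }
  pose proof (D h y Hh Hy).
  destruct (d h y) as [|[|[|]]] eqn:Ey; try lia.
  - apply d_zero in Ey; subst. lia.
  - apply d_one in Ey. rewrite (N1 y); auto.
  - apply d_two in Ey. pose proof (N2 y Hy Ey). destruct Ey as (N & A & c & C1 & C2).
    assert (Hc : H c) by (apply (C h y c); auto).
    pose proof (N1 c Hc C1). pose proof (d_adj_bounds x c y C2). pose proof (Mh y Hy).
    (* If [y] were only one level above [h], (TC) for the edge from [c] to [y] would give a point
       [m] of [H] on the level of [h]; [N1], [N2] and the non-adjacency of [h] and [y] exclude
       it. *)
    destruct (Nat.eq_dec (d x y) (d x h + 1)) as [E|]; [|lia]. exfalso.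
    destruct (d x h) as [|k] eqn:Ek.
    + apply d_zero in Ek; subst h. apply d_one in E. auto.
    + destruct (proj1 (WM x) c y) as (m & M1 & M2 & M3); try lia; [apply d_adj; auto|].
      assert (Hm : H m). { apply (C c y m); auto. intros ->; exact (Hirr _ C2). }
      destruct (classic (h = m)) as [->|N3]; [auto|].
      destruct (classic (adj h m)) as [B|B]; [pose proof (N1 m Hm B); lia|].
      apply (N2 m Hm); [|lia]. repeat split; auto. exists c; auto.
Qed.

Lemma interval_two u v z : d u v = 2 -> interval adj u v z -> z = u \/ z = v \/ (adj u z /\ adj z v).
Proof.
  intros H I. unfold interval in I. destruct (d u z) as [|[|]] eqn:E.
  - left. symmetry; apply d_zero; auto.
  - right; right. split; apply d_one; lia.
  - right; left. apply d_zero; lia.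
Qed.

(** The interval consists of [u], [v] and their common neighbours. A diagonal of the induced 4-cycle
    is not an edge, so it is either the pair [u], [v] or made of common neighbours; both diagonals
    cannot be of the first kind. *)
Lemma thick_pair : thick adj -> forall u v, far2 u v ->
  exists a b, adj u a /\ adj a v /\ adj u b /\ adj b v /\ a <> b /\ ~ adj a b.
Proof.
  intros Ht u v F. pose proof (proj2 (d_two u v) F) as D.
  destruct (Ht u v D) as (a & b & c & e & Ia & Ib & Ic & Ie & N1 & N2 & N3 & N4 & N5 & N6 &
    A1 & A2 & A3 & A4 & A5 & A6).
  apply (interval_two u v) in Ia, Ib, Ic, Ie; auto.
  assert (X : (adj u a /\ adj a v /\ adj u c /\ adj c v) \/ (adj u b /\ adj b v /\ adj u e /\ adj e v)).
  { destruct Ia as [?|[?|[? ?]]], Ic as [?|[?|[? ?]]], Ib as [?|[?|[? ?]]], Ie as [?|[?|[? ?]]];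
      subst; solve [congruence | exfalso; auto | auto 6]. }
  destruct X as [(X1 & X2 & X3 & X4)|(X1 & X2 & X3 & X4)]; [exists a, c|exists b, e]; auto 7.
Qed.

Lemma thick_other : diamond_free -> thick adj -> forall u v c, far2 u v -> adj u c -> adj c v ->
  exists y, adj u y /\ adj y v /\ y <> c /\ ~ adj y c.
Proof.
  intros Hdia Ht u v c F A B.
  destruct (thick_pair Ht u v F) as (a & b & A1 & A2 & B1 & B2 & N & Nab).
  destruct (classic (c = a)) as [->|Na]; [exists b; repeat split; auto|].
  destruct (classic (c = b)) as [->|Nb]; [exists a; repeat split; auto|].
  destruct (classic (adj a c)) as [Ac|Ac]; [|exists a; repeat split; auto].
  exists b. repeat split; auto. intros Bc.
  destruct (Hdia a b u c); auto.
Qed.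

Lemma weakly_modular_A1 : weakly_modular adj -> diamond_free -> A1 adj.
Proof.
  intros WM Hdia K [HK MK] x.
  assert (NE : exists y, K y).
  { apply NNPP; intros N. apply N. exists x. apply (MK (fun z => z = x)); auto.
    - intros y z -> ->; congruence.
    - intros y Hy. exfalso; eauto. }
  (* By [diamond_free] a vertex adjacent to two members of [K] is adjacent to all others, so
     maximality puts it in [K]. *)
  assert (Add : forall z y1 y2, K y1 -> K y2 -> y1 <> y2 -> adj z y1 -> adj z y2 -> K z).
  { intros z y1 y2 K1 K2 N A B. apply (MK (fun w => w = z \/ K w)); auto.
    assert (T : forall w, K w -> w <> z -> adj z w).
    { intros w Kw Nw. destruct (classic (w = y1)) as [->|W1]; auto.
      destruct (classic (w = y2)) as [->|W2]; auto.
      destruct (Hdia z w y1 y2); auto. congruence. }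
    intros p q [->|Kp] [->|Kq] Npq; auto. congruence. }
  destruct (argmin K (d x) NE) as (h & Kh & Mh).
  exists h. split; auto. intros y Ky. unfold interval.
  destruct (classic (h = y)) as [->|N]; [rewrite d_refl; lia|].
  assert (A : adj h y) by (apply HK; auto). rewrite (d_adj _ _ A).
  pose proof (d_adj_bounds x h y A). pose proof (Mh y Ky).
  destruct (Nat.eq_dec (d x y) (d x h)) as [E|]; [|lia]. exfalso.
  destruct (d x h) as [|[|k]] eqn:Ek.
  - apply d_zero in E, Ek. congruence.
  - apply d_one in E, Ek. pose proof (Mh x (Add x h y Kh Ky N Ek E)). rewrite d_refl in *. lia.
  - destruct (proj1 (WM x) h y) as (m & M1 & M2 & M3); try lia; [apply d_adj; auto|].
    pose proof (Mh m (Add m h y Kh Ky N M1 M2)). lia.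
Qed.

(** The two non-adjacent common neighbours given by thickness span an explicit gated set of diameter
    2 containing [u] and [v], hence their hull. *)
Lemma weakly_modular_A34 : weakly_modular adj -> diamond_free -> thick adj ->
  ~ has_isometric_K33minus adj -> A34 adj.
Proof.
  intros WM Hdia Ht HK u v Huv H.
  assert (Hltc : triangle_local) by (apply TC_triangle_local; intros; apply WM).
  pose proof (proj1 (d_two u v) Huv) as F.
  destruct (thick_pair Ht u v F) as (a & b & A1 & A2 & B1 & B2 & N & Nab).
  assert (Cab : ~ col a b) by (intros [|]; auto).
  assert (G : gated adj (quad_set u a b)).
  { apply closed_gated; auto.
    - exists u; left; auto.
    - apply quad_set_diam; auto.
    - intros x y c. apply quad_set_closed; auto. apply WM. }
  assert (S : forall x, H x -> quad_set u a b x).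
  { intros x Hx. apply Hx; auto. intros y [->| ->]; [left; auto|].
    right; right. repeat split; auto; try apply F; apply near_refl; auto. }
  split.
  - intros x y Hx Hy. apply (quad_set_diam Hdia Hltc HK u a b); auto.
  - exists u, v. repeat split; auto; [apply quad_l|apply quad_r].
Qed.

Lemma A34_A5 : diamond_free -> thick adj -> A34 adj -> A5 adj.
Proof.
  intros Hdia Ht HA.
  assert (Main : forall k u v x, d u v = 2 + k -> adj u x -> d x v = 1 + k ->
    exists y, adj v y /\ d u y = 1 + k /\ d x y = 2 + k).
  { induction k as [|k IH]; intros u v x Duv Aux Dxv.
    - apply d_one in Dxv. apply d_two in Duv.
      destruct (thick_other Hdia Ht u v x Duv Aux Dxv) as (y & Y1 & Y2 & Y3 & Y4).
      exists y. repeat split; auto; [apply d_adj; auto|]. apply d_two. repeat split; auto. exists u; auto.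
    - rewrite d_sym in Dxv. destruct (d_succ _ _ _ Dxv) as (v' & Avv' & Dv').
      rewrite d_sym in Dv'. rewrite d_sym in Dxv.
      pose proof (d_adj_bounds u v v' Avv'). pose proof (d_tri u x v') as T.
      rewrite (d_adj _ _ Aux) in T.
      (* Solve the problem for a neighbour [v'] of [v] nearer to [x], then complete [y'], [v'], [v]
         to a square whose fourth corner [y] is not adjacent to [v']. *)
      destruct (IH u v' x) as (y' & Ay' & Duy' & Dxy'); auto; try lia.
      assert (Fy' : far2 y' v).
      { repeat split; [intros ->; lia| |exists v'; auto].
        intros A. pose proof (d_adj_bounds u y' v A). lia. }
      destruct (thick_other Hdia Ht y' v v' Fy' (Hsym _ _ Ay') (Hsym _ _ Avv')) as (y & Y1 & Y2 & Y3 & Y4).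
      pose proof (d_adj_bounds u y' y Y1). pose proof (d_adj_bounds u y v Y2).
      exists y. repeat split; auto; [lia|].
      assert (Dvy : d v' y = 2).
      { apply d_two. repeat split; auto. exists v; auto. }
      destruct (HA y' v (proj2 (d_two _ _) Fy')) as [D _].
      change (gated_hull adj (fun z => z = y' \/ z = v)) with (quad y' v) in D.
      assert (Nyv : y' <> v) by apply Fy'.
      assert (Qv' : quad y' v v') by (apply (gated_common _ y' v); auto using quad_gated, quad_l, quad_r).
      assert (Qy : quad y' v y) by (apply (gated_common _ y' v); auto using quad_gated, quad_l, quad_r).
      pose proof (quad_l y' v) as Ql. pose proof (quad_r y' v) as Qr.
      (* In the quad of [y'] and [v], the gate of [u] is [y']. Comparing distances from [u] and [x]
         then forces the gate of [x] to be [v'], and [y] is 2 further from [x] than [v']. *)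
      destruct (quad_gated y' v u) as (g & Qg & Ig). destruct (quad_gated y' v x) as (h & Qh & Ih).
      pose proof (Ig _ Ql) as Igl. pose proof (Ig _ Qr) as Igr. pose proof (Ig _ Qh) as Igh.
      pose proof (Ih _ Ql) as Ihl. pose proof (Ih _ Qv') as Ihv. pose proof (Ih _ Qy) as Ihy.
      unfold interval in *. pose proof (D g v Qg Qr). pose proof (D h y' Qh Ql).
      assert (g = y') by (apply d_zero; lia). subst g.
      pose proof (d_tri u x h) as T2. rewrite (d_adj _ _ Aux), (d_sym h y') in *.
      destruct (d h v') as [|e] eqn:Eh; [|lia].
      apply d_zero in Eh; subst h. lia. }
  intros u v Nuv Auv x Aux I. unfold interval in I. rewrite (d_adj _ _ Aux) in I.
  destruct (d u v) as [|[|k]] eqn:Duv; [apply d_zero in Duv; tauto|apply d_one in Duv; tauto|].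
  destruct (Main k u v x) as (y & Y1 & Y2 & Y3); try lia; auto.
  exists y. unfold interval. rewrite (d_adj y v (Hsym _ _ Y1)), Duv. repeat split; auto; lia.
Qed.
(** * The cover by reduced walks *)

Section Cover.
Hypothesis Hdia : diamond_free.
Hypothesis Htri : triangle_local.
Hypothesis HLQC : forall u, LQC adj u.

Lemma edge_apex u v w a b : adj v w -> u <> v -> ~ adj u v -> u <> w -> ~ adj u w ->
  adj u a -> adj a v -> adj u b -> adj b w -> exists x, adj x u /\ adj x v /\ adj x w.
Proof. intros. apply Htri; auto; repeat split; eauto. Qed.

(** The last three hypotheses exclude [d u z] up to 2, so that (LQC) applies with [d u z = 3]. *)
Lemma square_apex u v w z a b : adj z v -> adj z w -> v <> w -> ~ adj v w ->
  u <> v -> ~ adj u v -> u <> w -> ~ adj u w -> adj u a -> adj a v -> adj u b -> adj b w ->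
  u <> z -> ~ adj u z -> (forall m, adj z m -> adj m u -> False) ->
  exists x, adj x u /\ adj x v /\ adj x w.
Proof.
  intros Azv Azw N A Nv Av Nw Aw A1 A2 B1 B2 Nz Az Hm.
  assert (Dv : d u v = 2) by (apply d_two; repeat split; eauto).
  assert (Dw : d u w = 2) by (apply d_two; repeat split; eauto).
  apply (HLQC u v w z); auto.
  - apply d_two. repeat split; auto. exists z; auto.
  - pose proof (d_adj_bounds u z v Azv).
    destruct (d u z) as [|[|[|[|]]]] eqn:Duz; try lia.
    + apply d_one in Duz; tauto.
    + apply d_two in Duz. destruct Duz as (_ & _ & m & M1 & M2). destruct (Hm m); auto.
Qed.

(* A walk is listed from its current end down to its base, so that extending it is [cons]. *)
Inductive swap : list V -> list V -> Prop :=
| swap_square x y z w q : adj x y -> adj y z -> adj x w -> adj w z ->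
    x <> z -> ~ adj x z -> y <> w -> ~ adj y w -> swap (x :: y :: z :: q) (x :: w :: z :: q)
| swap_cons a l l' : swap l l' -> swap (a :: l) (a :: l').

Inductive sqeq : list V -> list V -> Prop :=
| sqeq_refl l : sqeq l l
| sqeq_step l l' l'' : sqeq l l' -> swap l' l'' -> sqeq l l''.

Lemma sqeq_trans l1 l2 l3 : sqeq l1 l2 -> sqeq l2 l3 -> sqeq l1 l3.
Proof.
  intros H1 H2. induction H2 as [|l l' l'' _ IH Hs]; auto. exact (sqeq_step _ _ _ (IH H1) Hs).
Qed.

Lemma swap_sym l l' : swap l l' -> swap l' l.
Proof. induction 1; constructor; auto. Qed.

Lemma sqeq_swap l l' : swap l l' -> sqeq l l'.
Proof. intros. eapply sqeq_step; [apply sqeq_refl | auto]. Qed.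

Lemma sqeq_sym l l' : sqeq l l' -> sqeq l' l.
Proof.
  induction 1. constructor.
  eapply sqeq_trans; eauto. apply sqeq_swap, swap_sym; auto.
Qed.

Lemma sqeq_cons a l l' : sqeq l l' -> sqeq (a :: l) (a :: l').
Proof. induction 1; econstructor; eauto. constructor; auto. Qed.

Lemma sqeq_length l l' : sqeq l l' -> length l = length l'.
Proof.
  induction 1; auto. rewrite IHsqeq. clear -H0.
  induction H0; simpl; auto.
Qed.

Lemma sqeq_head x l l' : sqeq (x :: l) l' -> exists l0, l' = x :: l0.
Proof.
  intros H. remember (x :: l) as k. induction H as [|k0 k1 k2 _ IH Hs]; subst; eauto.
  destruct (IH eq_refl) as [l0 ->]. inversion Hs; subst; eauto.
Qed.

Lemma sqeq_heads x y l l' : sqeq (x :: l) (y :: l') -> x = y.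
Proof. intros H. destruct (sqeq_head _ _ _ H) as [? [= -> ->]]. reflexivity. Qed.

Lemma sqeq_last l l' b : sqeq l l' -> last l b = last l' b.
Proof.
  induction 1; auto. rewrite IHsqeq. clear -H0.
  induction H0; auto. destruct l, l'; try solve [inversion H0]. exact IHswap.
Qed.

Lemma sqeq_nil l : sqeq [] l -> l = [].
Proof. intros H. apply sqeq_length in H. destruct l; simpl in *; auto; lia. Qed.

Lemma sqeq_one x l : sqeq [x] l -> l = [x].
Proof.
  intros H. pose proof (sqeq_length _ _ H). destruct (sqeq_head _ _ _ H) as [[|] ->]; auto.
  simpl in *; lia.
Qed.

(** Two distinct common neighbours of vertices at distance 2 are never adjacent, by [diamond_free],
    so exchanging them is always a legal swap. *)
Lemma sqeq_alt y x m t s : adj y x -> adj x t -> adj y m -> adj m t -> y <> t -> ~ adj y t ->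
  sqeq (y :: x :: t :: s) (y :: m :: t :: s).
Proof.
  intros. destruct (classic (x = m)) as [->|N]. constructor.
  apply sqeq_swap. constructor; auto. intros A.
  destruct (Hdia y t x m); auto.
Qed.

(** No representative of [w] makes the extension by [z] a backtrack or two sides of a triangle. *)
Definition ascends (w : list V) (z : V) : Prop :=
  forall y x u, sqeq w (y :: x :: u) -> x <> z /\ ~ adj x z.

Inductive reduced : list V -> Prop :=
| reduced_one x : reduced [x]
| reduced_cons z y l : reduced (y :: l) -> adj z y -> ascends (y :: l) z -> reduced (z :: y :: l).

Lemma ascends_sqeq w w' z : sqeq w w' -> ascends w z -> ascends w' z.
Proof. intros H U y x u H'. eapply U. eapply sqeq_trans; eauto. Qed.

Lemma reduced_tail z w : reduced (z :: w) -> w <> [] -> reduced w.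
Proof. intros H N. inversion H; subst; auto. congruence. Qed.

Lemma reduced_adj z y l : reduced (z :: y :: l) -> adj z y.
Proof. inversion 1; auto. Qed.

Lemma reduced_ascends z y l : reduced (z :: y :: l) -> ascends (y :: l) z.
Proof. inversion 1; auto. Qed.

Lemma reduced3 z y t l : reduced (z :: y :: t :: l) -> adj z y /\ adj y t /\ z <> t /\ ~ adj z t.
Proof.
  intros G. pose proof (reduced_adj _ _ _ G). pose proof (reduced_ascends _ _ _ G _ _ _ (sqeq_refl _)) as [].
  pose proof (reduced_adj _ _ _ (reduced_tail _ _ G ltac:(discriminate))). repeat split; auto.
Qed.

(* A shortcut from [z] to [t] would give, through (LTC), a square swap exposing a triangle. *)
Lemma far3 z y x t s : adj z y -> adj y x -> adj x t -> y <> t -> ~ adj y t ->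
  ascends (y :: x :: t :: s) z ->
  z <> t /\ ~ adj z t /\ (forall m, adj z m -> adj m t -> False).
Proof.
  intros Hzy Hyx Hxt Nyt Ayt U.
  assert (U' : forall m, adj y m -> adj m t -> m <> z /\ ~ adj m z).
  { intros m H1 H2. eapply (U y m (t :: s)). apply sqeq_alt; auto. }
  assert (Nzt : z <> t) by (intros ->; auto).
  assert (Azt : ~ adj z t). { intros A. destruct (U' z); auto. }
  repeat split; auto. intros m H1 H2.
  destruct (edge_apex t y z x m) as (c & A & B & C); auto.
  destruct (U' c); auto.
Qed.

(** * Reducedness and forks under square swaps *)

Definition same_or_fork (w w' : list V) : Prop :=
  sqeq w w' \/ exists y y' t s, sqeq w (y :: t :: s) /\ sqeq w' (y' :: t :: s).

Definition reduced_closed n := forall l l', length l = n -> reduced l -> sqeq l l' -> reduced l'.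
Definition tail_forks n := forall z w w', length w = n -> reduced (z :: w) -> sqeq (z :: w) (z :: w') -> same_or_fork w w'.

(** Two forks meet in the middle walk, whose own tails, over [t1] and [t2], agree or fork over some
    [t] by [HT]. In the latter case [t] lies three steps below [z], and an apex over [t] merges the
    forks into one. *)
Lemma same_or_fork_trans n z w1 w2 w3 : (forall m, m <= S n -> reduced_closed m) -> (forall m, m < n -> tail_forks m) ->
  length w2 = n -> reduced (z :: w1) -> reduced (z :: w2) -> reduced (z :: w3) ->
  same_or_fork w1 w2 -> same_or_fork w2 w3 -> same_or_fork w1 w3.
Proof.
  intros HG HT Hn G1 G2 G3 [H12|(y1 & y2 & t1 & s1 & H1 & H2)].
  { intros [H23|(y1 & y2 & t1 & s1 & H1 & H2)].
    - left. eapply sqeq_trans; eauto.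
    - right. exists y1, y2, t1, s1. split; auto. eapply sqeq_trans; eauto. }
  intros [H23|(y2' & y3 & t2 & s2 & H2' & H3)].
  { right. exists y1, y2, t1, s1. split; auto. eapply sqeq_trans; [apply sqeq_sym|]; eauto. }
  assert (K : sqeq (y2 :: t1 :: s1) (y2' :: t2 :: s2)).
  { eapply sqeq_trans; [apply sqeq_sym|]; eauto. }
  pose proof (sqeq_heads _ _ _ _ K); subst y2'.
  assert (Gs : forall w y t s, sqeq w (y :: t :: s) -> length w = n -> reduced (z :: w) -> reduced (z :: y :: t :: s)).
  { intros. eapply HG; [| | eauto | apply sqeq_cons; eauto]. 2: reflexivity. simpl; lia. }
  assert (L1 : length w1 = n). { rewrite (sqeq_length _ _ H1), <- Hn, (sqeq_length _ _ H2). reflexivity. }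
  assert (L3 : length w3 = n). { rewrite (sqeq_length _ _ H3), <- Hn, (sqeq_length _ _ H2'). reflexivity. }
  pose proof (Gs _ _ _ _ H1 L1 G1) as G1'.
  pose proof (Gs _ _ _ _ H2 Hn G2) as G2'.
  pose proof (Gs _ _ _ _ H3 L3 G3) as G3'.
  assert (K' : same_or_fork (t1 :: s1) (t2 :: s2)).
  { eapply HT; [| reflexivity | | exact K].
    - rewrite <- Hn, (sqeq_length _ _ H2). simpl; lia.
    - eapply reduced_tail; eauto. discriminate. }
  destruct K' as [K'|(x1 & x2 & t & s & K1 & K2)].
  - right. exists y1, y3, t1, s1. split; auto. eapply sqeq_trans; [exact H3|]. apply sqeq_cons, sqeq_sym; auto.
  - pose proof (sqeq_heads _ _ _ _ K1); subst x1.
    pose proof (sqeq_heads _ _ _ _ K2); subst x2.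
    assert (M1 : sqeq w1 (y1 :: t1 :: t :: s)) by (eapply sqeq_trans; [exact H1 | apply sqeq_cons; auto]).
    assert (M2 : sqeq w2 (y2 :: t1 :: t :: s)) by (eapply sqeq_trans; [exact H2 | apply sqeq_cons; auto]).
    assert (M3 : sqeq w3 (y3 :: t2 :: t :: s)) by (eapply sqeq_trans; [exact H3 | apply sqeq_cons; auto]).
    pose proof (Gs _ _ _ _ M1 L1 G1) as F1.
    pose proof (Gs _ _ _ _ M2 Hn G2) as F2.
    pose proof (Gs _ _ _ _ M3 L3 G3) as F3.
    pose proof (reduced3 _ _ _ _ F1) as (A1 & A2 & A3 & A4).
    pose proof (reduced3 _ _ _ _ F2) as (B1 & B2 & B3 & B4).
    pose proof (reduced3 _ _ _ _ F3) as (C1 & C2 & C3 & C4).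
    destruct (reduced3 _ _ _ _ (reduced_tail _ _ F1 ltac:(discriminate))) as (D1 & D2 & D3 & D4).
    destruct (reduced3 _ _ _ _ (reduced_tail _ _ F2 ltac:(discriminate))) as (D1' & D2' & D3' & D4').
    destruct (reduced3 _ _ _ _ (reduced_tail _ _ F3 ltac:(discriminate))) as (I1 & I2 & I3 & I4).
    destruct (far3 z y2 t1 t s) as (J1 & J2 & J3); auto. { eapply reduced_ascends; eauto. }
    destruct (classic (y1 = y3)) as [->|N13].
    { left. eapply sqeq_trans; [exact M1|]. apply sqeq_sym. eapply sqeq_trans; [exact M3|]. apply sqeq_alt; auto. }
    (* [x] becomes the common vertex below [y1] and [y3]: it comes from (LTC) when they are
       adjacent, and otherwise from (LQC) for the corner [z], which [far3] puts at distance 3 from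
       [t]. *)
    assert (X : exists x, adj x t /\ adj x y1 /\ adj x y3).
    { destruct (classic (adj y1 y3)).
      - apply (edge_apex t y1 y3 t1 t2); auto.
      - apply (square_apex t y1 y3 z t1 t2); auto. }
    destruct X as (x & X1 & X2 & X3).
    right. exists y1, y3, x, (t :: s). split.
    + eapply sqeq_trans; [exact M1|]. apply sqeq_alt; auto.
    + eapply sqeq_trans; [exact M3|]. apply sqeq_alt; auto.
Qed.

(** Joint strong induction. Both halves concern walks with [n + 1] vertices, since [tail_forks n]
    measures the tail; forks of shorter walks serve to show that a swap at the top keeps a walk
    reduced. *)
Lemma sqeq_reduced_tail n : reduced_closed (S n) /\ tail_forks n.
Proof.
  induction n as [n IH] using (well_founded_induction lt_wf).
  assert (HG : forall m, m <= n -> reduced_closed m).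
  { intros [|m] Hm. intros [|] l' Hl; simpl in *; try lia. inversion 1.
    apply IH; lia. }
  assert (HT : forall m, m < n -> tail_forks m) by (intros; apply IH; auto).
  assert (HS : forall l l', length l = S n -> reduced l -> swap l l' -> reduced l').
  { intros l l' Hl G Hsw. inversion Hsw; subst.
    - match type of Hsw with swap (?a :: ?b :: ?c :: ?e) (_ :: ?f :: _ :: _) =>
        rename a into Z, b into Y, c into X, e into Q, f into Y' end.
      simpl in Hl.
      (* Every vertex [t] that can follow [X] is at distance 3 from [Z], so no vertex adjacent to
         [t] can equal or be adjacent to [Z]. *)
      assert (Hf : forall t s, sqeq (X :: Q) (X :: t :: s) ->
        sqeq (Y :: X :: Q) (Y :: X :: t :: s) /\ adj Y X /\ adj X t /\ Y <> t /\ ~ adj Y t /\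
        Z <> t /\ ~ adj Z t /\ forall m, adj Z m -> adj m t -> False).
      { intros t s K.
        assert (K' : sqeq (Y :: X :: Q) (Y :: X :: t :: s)) by (apply sqeq_cons; auto).
        assert (G' : reduced (Y :: X :: t :: s)).
        { eapply HG; [| | eapply reduced_tail; eauto; discriminate | exact K']. 2: reflexivity.
          simpl; lia. }
        destruct (reduced3 _ _ _ _ G') as (A1 & A2 & A3 & A4).
        destruct (far3 Z Y X t s) as (J1 & J2 & J3); auto.
        { eapply ascends_sqeq; eauto. eapply reduced_ascends; eauto. }
        repeat (split; [assumption|]). assumption. }
      assert (G1 : reduced (Y' :: X :: Q)).
      { constructor; auto.
        - eapply reduced_tail; [eapply reduced_tail; [exact G|]|]; discriminate.
        - intros x' t s K. pose proof (sqeq_heads _ _ _ _ K); subst x'.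
          destruct (Hf _ _ K) as (_ & _ & _ & _ & _ & J1 & J2 & J3). split.
          + intros ->. auto.
          + intros A. apply (J3 Y'); auto. }
      constructor; auto.
      intros x' x u K. pose proof (sqeq_heads _ _ _ _ K); subst x'.
      assert (K' : same_or_fork (X :: Q) (x :: u)).
      { eapply HT; [| reflexivity | exact G1 | exact K]. simpl; lia. }
      destruct K' as [K'|(x1 & x2 & t & s & K1 & K2)].
      + pose proof (sqeq_heads _ _ _ _ K'); subst x. split; auto.
      + pose proof (sqeq_heads _ _ _ _ K1); subst x1.
        pose proof (sqeq_heads _ _ _ _ K2); subst x2.
        destruct (Hf _ _ K1) as (M & A1 & A2 & A3 & A4 & J1 & J2 & J3).
        assert (G' : reduced (Y' :: x :: t :: s)).
        { eapply HG; [| | exact G1 | eapply sqeq_trans; [exact K | apply sqeq_cons; exact K2]].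
          2: reflexivity. simpl; lia. }
        destruct (reduced3 _ _ _ _ G') as (B1 & B2 & B3 & B4).
        assert (G'' : reduced (x :: t :: s)) by (eapply reduced_tail; eauto; discriminate).
        pose proof (reduced_adj _ _ _ G''). split.
        * intros ->; auto.
        * intros A. apply (J3 x); auto.
    - destruct l0 as [|y l0]; [inversion H|].
      destruct (sqeq_head y l0 l'0 (sqeq_swap _ _ H)) as [l1 ->].
      constructor.
      + eapply HG; [| | eapply reduced_tail; eauto; discriminate | apply sqeq_swap; exact H]. 2: reflexivity.
        simpl in *; lia.
      + eapply reduced_adj; eauto.
      + eapply ascends_sqeq; [apply sqeq_swap; exact H|]. eapply reduced_ascends; eauto. }
  assert (HG' : reduced_closed (S n)).
  { intros l l' Hl G HE. induction HE; auto. eapply HS; [| | eauto]; auto.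
    rewrite <- (sqeq_length _ _ HE); auto. }
  split; auto.
  assert (HG2 : forall m, m <= S n -> reduced_closed m).
  { intros m Hm. destruct (le_lt_eq_dec _ _ Hm) as [Hm'| -> ]; auto. apply HG; lia. }
  intros z w w' Hl G HE. remember (z :: w) as l. remember (z :: w') as l'.
  revert w' Heql'. induction HE; intros; subst.
  - injection Heql' as ->. left; constructor.
  - destruct (sqeq_head _ _ _ HE) as [w0 ->].
    assert (G0 : reduced (z :: w0)).
    { eapply HG'; [| exact G | exact HE]. simpl; auto. }
    assert (L0 : length w0 = length w) by (apply sqeq_length in HE; simpl in HE; lia).
    eapply (same_or_fork_trans _ z w w0 w'); eauto.
    + eapply HG'; [| exact G0 | apply sqeq_swap; exact H]. simpl; lia.
    + inversion H; subst.
      * right. do 4 eexists. split; apply sqeq_refl.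
      * left. apply sqeq_swap; auto.
Qed.

Lemma reduced_sqeq l l' : reduced l -> sqeq l l' -> reduced l'.
Proof.
  intros G H. destruct l. inversion G.
  eapply (proj1 (sqeq_reduced_tail (length l))); eauto. reflexivity.
Qed.

Lemma reduced_same_or_fork z w w' : reduced (z :: w) -> sqeq (z :: w) (z :: w') -> same_or_fork w w'.
Proof. intros G H. eapply (proj2 (sqeq_reduced_tail (length w))); eauto. Qed.

(* Edges of the cover: [g] is the neighbour of [w] over [z], one level below, on the same level (through a common lower neighbour over [x]), or one level above. *)
Inductive lift (w : list V) (z : V) (g : list V) : Prop :=
| lift_down y u : sqeq w (y :: z :: u) -> sqeq (z :: u) g -> lift w z g
| lift_flat y x u : sqeq w (y :: x :: u) -> adj x z -> adj y z -> sqeq (z :: x :: u) g -> lift w z g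
| lift_up : reduced (z :: w) -> sqeq (z :: w) g -> lift w z g.

Lemma lift_El w w' z g : sqeq w w' -> lift w z g -> lift w' z g.
Proof.
  intros H. pose proof (sqeq_sym _ _ H) as H'. intros [y u H1 H2|y x u H1 H2 H3 H4|H1 H2].
  - apply (lift_down w' z g y u); auto. eapply sqeq_trans; eauto.
  - apply (lift_flat w' z g y x u); auto. eapply sqeq_trans; eauto.
  - apply lift_up.
    + eapply reduced_sqeq; [exact H1|]. apply sqeq_cons; auto.
    + eapply sqeq_trans; [apply sqeq_cons; exact H'|]; auto.
Qed.

Lemma lift_Er w z g g' : sqeq g g' -> lift w z g -> lift w z g'.
Proof.
  intros H [y u H1 H2|y x u H1 H2 H3 H4|H1 H2].
  - apply (lift_down w z g' y u); auto. eapply sqeq_trans; eauto.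
  - apply (lift_flat w z g' y x u); auto. eapply sqeq_trans; eauto.
  - apply lift_up; auto. eapply sqeq_trans; eauto.
Qed.

(** If [z] were adjacent to a vertex [t] below [x], then [y] and [t], both adjacent to [x] and [z],
    would be equal or adjacent. *)
Lemma flat_reduced w y x u z : reduced w -> sqeq w (y :: x :: u) -> adj x z -> adj y z -> reduced (z :: x :: u).
Proof.
  intros G H A B. pose proof (reduced_sqeq _ _ G H) as G1.
  assert (G2 : reduced (x :: u)) by (eapply reduced_tail; eauto; discriminate).
  constructor; auto. intros x' t s K. pose proof (sqeq_heads _ _ _ _ K); subst x'.
  pose proof (reduced_sqeq _ _ G1 (sqeq_cons y _ _ K)) as G3.
  destruct (reduced3 _ _ _ _ G3) as (C1 & C2 & C3 & C4). split.
  - intros ->; auto.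
  - intros D. destruct (Hdia y t x z); auto.
Qed.

Lemma lower_adj w y x u : reduced w -> sqeq w (y :: x :: u) -> adj y x.
Proof. intros G H. eapply reduced_adj, reduced_sqeq; eauto. Qed.

Lemma lift_head w z g : lift w z g -> exists l, g = z :: l.
Proof. intros [y u H1 H2|y x u H1 H2 H3 H4|H1 H2]; eapply sqeq_head; eauto. Qed.

Lemma lift_good w z g : reduced w -> lift w z g -> reduced g.
Proof.
  intros G [y u H1 H2|y x u H1 H2 H3 H4|H1 H2].
  - eapply reduced_sqeq; [|eauto]. eapply reduced_tail; [eapply reduced_sqeq; eauto|discriminate].
  - eapply reduced_sqeq; [|eauto]. eapply flat_reduced; eauto.
  - eapply reduced_sqeq; eauto.
Qed.

Lemma lift_ex y l z : reduced (y :: l) -> adj y z -> exists g, lift (y :: l) z g.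
Proof.
  intros G A.
  destruct (classic (exists u, sqeq (y :: l) (y :: z :: u))) as [[u H]|N1].
  { exists (z :: u). eapply lift_down; eauto. constructor. }
  destruct (classic (exists x u, sqeq (y :: l) (y :: x :: u) /\ adj x z)) as [(x & u & H & B)|N2].
  { exists (z :: x :: u). eapply lift_flat; eauto. constructor. }
  exists (z :: y :: l). apply lift_up; [|constructor]. constructor; auto.
  intros y' x u H. pose proof (sqeq_heads _ _ _ _ H); subst y'. split.
  - intros ->; eauto.
  - intros B; eauto 6.
Qed.

(** The form in which the fork property is used: two vertices below the same end agree or are
    opposite corners of a square with lower corner [t]. Adjacency of the two would make [y] and [t]
    adjacent. *)
Lemma lowers w y x u y' x' u' : reduced w -> sqeq w (y :: x :: u) -> sqeq w (y' :: x' :: u') ->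
  y = y' /\ ((x = x' /\ sqeq (x :: u) (x' :: u')) \/
  (x <> x' /\ ~ adj x x' /\ exists t s, sqeq (x :: u) (x :: t :: s) /\ sqeq (x' :: u') (x' :: t :: s) /\
    adj y x /\ adj y x' /\ adj x t /\ adj x' t /\ y <> t /\ ~ adj y t)).
Proof.
  intros G H H'.
  assert (K : sqeq (y :: x :: u) (y' :: x' :: u')) by (eapply sqeq_trans; [apply sqeq_sym|]; eauto).
  pose proof (sqeq_heads _ _ _ _ K); subst y'. split; auto.
  pose proof (reduced_sqeq _ _ G H) as G1. pose proof (reduced_sqeq _ _ G H') as G1'.
  destruct (reduced_same_or_fork _ _ _ G1 K) as [L|(a & b & t & s & L1 & L2)].
  - left. split; auto. eapply sqeq_heads; eauto.
  - pose proof (sqeq_heads _ _ _ _ L1); subst a. pose proof (sqeq_heads _ _ _ _ L2); subst b.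
    destruct (classic (x = x')) as [->|N].
    { left. split; auto. eapply sqeq_trans; [|apply sqeq_sym]; eauto. }
    right. destruct (reduced3 _ _ _ _ (reduced_sqeq _ _ G1 (sqeq_cons y _ _ L1))) as (A1 & A2 & A3 & A4).
    destruct (reduced3 _ _ _ _ (reduced_sqeq _ _ G1' (sqeq_cons y _ _ L2))) as (B1 & B2 & B3 & B4).
    split; auto. split.
    + intros C. destruct (Hdia y t x x'); auto.
    + exists t, s. repeat (split; [assumption|]). assumption.
Qed.

Lemma up_not_lower w z y x u : reduced (z :: w) -> sqeq w (y :: x :: u) -> x <> z /\ ~ adj x z.
Proof.
  intros G H. destruct w; [apply sqeq_nil in H; discriminate|]. eapply (reduced_ascends _ _ _ G); eauto.
Qed.

(** The three kinds of edges exclude each other. Two flat lifts through distinct [x] and [x'] would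
    make these adjacent, being common neighbours of the edge from [y] to [z]. *)
Lemma lift_unique w z g g' : reduced w -> lift w z g -> lift w z g' -> sqeq g g'.
Proof.
  assert (DF : forall y u y' x' u', reduced w -> sqeq w (y :: z :: u) -> sqeq w (y' :: x' :: u') -> adj x' z -> adj y' z -> False).
  { intros y u y' x' u' G H1 H2 A B.
    destruct (lowers _ _ _ _ _ _ _ G H1 H2) as [<- [[-> _]|(_ & N & _)]]; [exact (Hirr _ A)|auto]. }
  assert (S : forall k, sqeq k g -> sqeq k g' -> sqeq g g').
  { intros. eapply sqeq_trans; [apply sqeq_sym|]; eauto. }
  intros G [y u H1 H2|y x u H1 H2 H3 H4|H1 H2] [y' u' H1' H2'|y' x' u' H1' H2' H3' H4'|H1' H2'].
  - destruct (lowers _ _ _ _ _ _ _ G H1 H1') as [<- [[_ C]|(N & _)]]; [|congruence].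
    eapply S; eauto. eapply sqeq_trans; eauto.
  - exfalso; eauto.
  - destruct (up_not_lower _ _ _ _ _ H1' H1); congruence.
  - exfalso; eauto.
  - destruct (lowers _ _ _ _ _ _ _ G H1 H1') as [<- [[_ C]|(N & N' & t & s & _ & _ & A1 & A2 & A3)]].
    + eapply S; eauto. eapply sqeq_trans; [apply sqeq_cons; eauto|]; eauto.
    + destruct (Hdia x x' y z); auto; tauto.
  - destruct (up_not_lower _ _ _ _ _ H1' H1); tauto.
  - destruct (up_not_lower _ _ _ _ _ H1 H1'); congruence.
  - destruct (up_not_lower _ _ _ _ _ H1 H1'); tauto.
  - eauto.
Qed.

Lemma lift_back y l z g : reduced (y :: l) -> lift (y :: l) z g -> lift g y (y :: l).
Proof.
  intros G [y' u H1 H2|y' x u H1 H2 H3 H4|H1 H2].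
  - pose proof (sqeq_heads _ _ _ _ H1); subst y'. apply (lift_El (z :: u)); auto.
    apply lift_up; [eapply reduced_sqeq; eauto | apply sqeq_sym; auto].
  - pose proof (sqeq_heads _ _ _ _ H1); subst y'. apply (lift_El (z :: x :: u)); auto.
    apply (lift_flat _ _ _ z x u); auto; [constructor| |apply sqeq_sym; auto].
    apply Hsym. eapply reduced_adj. eapply reduced_sqeq; eauto.
  - apply (lift_El (z :: y :: l)); auto. eapply lift_down; constructor.
Qed.

Lemma lift_adj y l z g : reduced (y :: l) -> lift (y :: l) z g -> adj y z.
Proof.
  intros G [y' u H1 H2|y' x u H1 H2 H3 H4|H1 H2].
  - pose proof (sqeq_heads _ _ _ _ H1); subst y'. eapply reduced_adj, reduced_sqeq; eauto.
  - pose proof (sqeq_heads _ _ _ _ H1); subst y'; auto.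
  - apply Hsym. eapply reduced_adj; eauto.
Qed.

Lemma lift_length w z g : lift w z g ->
  length w <= length g + 1 /\ length g <= length w + 1.
Proof.
  intros [y u H1 H2|y x u H1 H2 H3 H4|H1 H2]; apply sqeq_length in H1 || idtac;
    match goal with H : sqeq _ g |- _ => apply sqeq_length in H end; simpl in *; lia.
Qed.

Lemma lift_last y l z g b : lift (y :: l) z g -> last g b = last (y :: l) b.
Proof.
  intros [y' u H1 H2|y' x u H1 H2 H3 H4|H1 H2]; try (rewrite (sqeq_last _ _ b H1));
    match goal with H : sqeq _ g |- _ => rewrite <- (sqeq_last _ _ b H) end; reflexivity.
Qed.

Lemma lift_triangle y l z z' g g' : reduced (y :: l) -> adj z z' ->
  lift (y :: l) z g -> lift (y :: l) z' g' -> lift g z' g'.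
Proof.
  intros G A L L'. pose proof (lift_adj _ _ _ _ G L) as B. pose proof (lift_adj _ _ _ _ G L') as B'.
  (* By uniqueness it suffices to exhibit one walk that is a lift over [z'] from both starting
     points. *)
  assert (U : forall h, lift (y :: l) z' h -> lift g z' h -> lift g z' g').
  { intros h H1 H2. eapply lift_Er; [|exact H2]. eapply lift_unique; eauto. }
  destruct L as [y' u H1 H2|y' x u H1 H2 H3 H4|H1 H2].
  - pose proof (sqeq_heads _ _ _ _ H1); subst y'.
    apply (U (z' :: z :: u)).
    + eapply lift_flat; eauto. constructor.
    + eapply lift_El; eauto. apply lift_up; [|constructor]. eapply flat_reduced; eauto.
  - pose proof (sqeq_heads _ _ _ _ H1); subst y'.
    pose proof (lower_adj _ _ _ _ G H1) as C.
    destruct (classic (x = z')) as [->|N].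
    + apply (U (z' :: u)); [eapply lift_down; eauto; constructor|].
      eapply lift_El; eauto. eapply lift_down; constructor.
    + assert (D : adj x z') by (destruct (Hdia x z' y z); auto; congruence).
      apply (U (z' :: x :: u)); [eapply lift_flat; eauto; constructor|].
      eapply lift_El; eauto. eapply lift_flat; try constructor; auto.
  - destruct L' as [y' u' H1' H2'|y' x' u' H1' H2' H3' H4'|H1' H2'].
    + destruct (up_not_lower _ _ _ _ _ H1 H1') as [_ N]. exfalso; auto.
    + pose proof (sqeq_heads _ _ _ _ H1'); subst y'.
      destruct (up_not_lower _ _ _ _ _ H1 H1') as [N N'].
      pose proof (lower_adj _ _ _ _ G H1').
      destruct (Hdia x' z y z'); auto; tauto.
    + eapply lift_El; eauto. apply (lift_flat _ _ _ z y l); auto. constructor.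
Qed.

(* By induction on the level, a square with a corner below the starting one closes up from that corner; otherwise the starting corner is the lowest and the types of its two edges are compared. *)
Lemma lift_square n : forall y l z q z' g k h h', length (y :: l) = n -> reduced (y :: l) ->
  lift (y :: l) z g -> lift (y :: l) z' k -> lift g q h -> lift k q h' ->
  y <> q -> ~ adj y q -> z <> z' -> ~ adj z z' -> sqeq h h'.
Proof.
  induction n as [n IH] using (well_founded_induction lt_wf).
  intros y l z q z' g k h h' Hn G Lg Lk Lh Lh' Nyq Ayq Nzz Azz.
  (* A lower corner over [z] or [q]: apply the induction hypothesis to the square read from that
     corner, and return by [lift_back]. *)
  assert (T : forall z z' g k h h', lift (y :: l) z g -> lift (y :: l) z' k -> lift g q h -> lift k q h' ->
    z <> z' -> ~ adj z z' -> length g < n \/ length h < n -> sqeq h h').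
  { clear z z' g k h h' Lg Lk Lh Lh' Nzz Azz.
    intros z z' g k h h' Lg Lk Lh Lh' Nzz Azz [Hlt|Hlt].
    - destruct (lift_head _ _ _ Lg) as [g0 ->]. destruct (lift_head _ _ _ Lk) as [k0 ->].
      destruct (lift_head _ _ _ Lh) as [h0 ->].
      pose proof (lift_good _ _ _ G Lg) as Gg. pose proof (lift_good _ _ _ G Lk) as Gk.
      pose proof (lift_good _ _ _ Gg Lh) as Gh.
      assert (Aq : adj q z') by (apply Hsym; eapply lift_adj; [exact Gk|exact Lh']).
      destruct (lift_ex q h0 z' Gh Aq) as [k2 Lk2].
      assert (K : sqeq (z' :: k0) k2).
      { eapply (IH _ Hlt z g0 y z' q (y :: l) (q :: h0)); eauto. eapply lift_back; eauto. }
      apply (lift_Er _ _ _ _ (sqeq_sym _ _ K)) in Lk2.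
      eapply lift_unique; [exact Gk| |exact Lh']. eapply lift_back; eauto.
    - destruct (lift_head _ _ _ Lg) as [g0 ->]. destruct (lift_head _ _ _ Lk) as [k0 ->].
      destruct (lift_head _ _ _ Lh) as [h0 ->].
      pose proof (lift_good _ _ _ G Lg) as Gg. pose proof (lift_good _ _ _ G Lk) as Gk.
      pose proof (lift_good _ _ _ Gg Lh) as Gh.
      assert (Aq : adj q z') by (apply Hsym; eapply lift_adj; [exact Gk|exact Lh']).
      assert (Ay : adj y z') by (eapply lift_adj; [exact G|exact Lk]).
      destruct (lift_ex q h0 z' Gh Aq) as [m Lm].
      destruct (lift_head _ _ _ Lm) as [m0 ->].
      pose proof (lift_good _ _ _ Gh Lm) as Gm.
      destruct (lift_ex z' m0 y Gm (Hsym _ _ Ay)) as [w2 Lw2].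
      assert (K : sqeq (y :: l) w2).
      { eapply (IH _ Hlt q h0 z y z' (z :: g0) (z' :: m0)); eauto.
        - eapply lift_back; eauto.
        - eapply lift_back; eauto. }
      apply (lift_Er _ _ _ _ (sqeq_sym _ _ K)) in Lw2.
      assert (K2 : sqeq (z' :: m0) (z' :: k0)).
      { eapply lift_unique; [exact G| |exact Lk]. eapply lift_back; eauto. }
      eapply lift_unique; [exact Gk| |exact Lh'].
      eapply lift_El; [exact K2|]. eapply lift_back; eauto. }
  destruct (le_lt_dec n (length g)) as [Hg|Hg]; [|eapply (T z z' g k h h'); eauto].
  destruct (le_lt_dec n (length h)) as [Hh|Hh]; [|eapply (T z z' g k h h'); eauto].
  destruct (le_lt_dec n (length k)) as [Hk|Hk]; [|apply sqeq_sym; eapply (T z' z k g h' h); eauto].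
  destruct (le_lt_dec n (length h')) as [Hh'|Hh']; [|apply sqeq_sym; eapply (T z' z k g h' h); eauto].
  clear T.
  pose proof (lift_adj _ _ _ _ G Lg) as Ayz. pose proof (lift_adj _ _ _ _ G Lk) as Ayz'.
  pose proof (lift_good _ _ _ G Lg) as Gg. pose proof (lift_good _ _ _ G Lk) as Gk.
  assert (Azq : adj z q). { destruct (lift_head _ _ _ Lg) as [g0 ->]. eapply lift_adj; [exact Gg|exact Lh]. }
  assert (Azq' : adj z' q). { destruct (lift_head _ _ _ Lk) as [k0 ->]. eapply lift_adj; [exact Gk|exact Lh']. }
  (* Both edges from the start go up. If [q] is below [z] or level with it, it is so for [z'] too;
     otherwise it is above. *)
  assert (UU : forall z z' h h', adj y z -> adj y z' -> adj z q -> adj z' q -> z <> z' -> ~ adj z z' ->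
    reduced (z :: y :: l) -> reduced (z' :: y :: l) -> lift (z :: y :: l) q h -> lift (z' :: y :: l) q h' ->
    sqeq h h' \/ sqeq (q :: z :: y :: l) h).
  { clear z z' g k h h' Lg Lk Lh Lh' Nzz Azz Hg Hk Hh Hh' Ayz Ayz' Azq Azq' Gg Gk.
    intros z z' h h' Ayz Ayz' Azq Azq' Nzz Azz Gg Gk [z0 u H1 H2|z0 x u H1 H2 H3 H4|H1 H2] Lh'; auto; left.
    - destruct (lowers _ _ _ _ _ _ _ Gg (sqeq_refl _) H1) as [<- [[-> _]|(N & N' & t & s & K1 & K2 & A1 & A2 & A3 & A4 & A5 & A6)]].
      { congruence. }
      destruct (reduced3 _ _ _ _ (reduced_sqeq _ _ Gk (sqeq_cons z' _ _ K1))) as (B1 & B2 & B3 & B4).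
      eapply lift_unique; [exact Gk| |exact Lh'].
      eapply lift_down with (y := z'); [|eapply sqeq_trans; [apply sqeq_sym; exact K2|exact H2]].
      eapply sqeq_trans; [apply sqeq_cons; exact K1|]. apply sqeq_alt; auto.
    - destruct (lowers _ _ _ _ _ _ _ Gg (sqeq_refl _) H1) as [<- [[-> _]|(N & N' & t & s & K1 & K2 & A1 & A2 & A3 & A4 & A5 & A6)]].
      { tauto. }
      destruct (reduced3 _ _ _ _ (reduced_sqeq _ _ Gk (sqeq_cons z' _ _ K1))) as (B1 & B2 & B3 & B4).
      assert (Ntq : t <> q) by (intros ->; auto).
      assert (Atq : ~ adj t q).
      { intros C. destruct (Hdia t z x q); auto. }
      destruct (edge_apex t q z' x y) as (m & M1 & M2 & M3); auto.
      apply sqeq_trans with (q :: m :: t :: s).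
      + eapply sqeq_trans; [apply sqeq_sym; exact H4|]. eapply sqeq_trans; [apply sqeq_cons; exact K2|].
        apply sqeq_alt; auto.
      + eapply lift_unique; [exact Gk| |exact Lh'].
        eapply lift_flat with (y := z') (x := m); [| | |apply sqeq_refl]; auto.
        eapply sqeq_trans; [apply sqeq_cons; exact K1|]. apply sqeq_alt; auto. }
  (* One edge is flat and the other goes up. By (LTC) there is [m] above [x] and adjacent to [z']
     and [q], so [q] is level with [z'] and one above [z]. *)
  assert (FU : forall z z' g k h h' y' x u, adj y z -> adj y z' -> adj z q -> adj z' q -> z <> z' -> ~ adj z z' ->
    sqeq (y :: l) (y' :: x :: u) -> adj x z -> sqeq (z :: x :: u) g ->
    reduced (z' :: y :: l) -> sqeq (z' :: y :: l) k -> lift g q h -> lift k q h' -> sqeq h h').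
  { clear z z' g k h h' Lg Lk Lh Lh' Nzz Azz Hg Hk Hh Hh' Ayz Ayz' Azq Azq' Gg Gk UU.
    intros z z' g k h h' y' x u Ayz Ayz' Azq Azq' Nzz Azz H1 H2 H3 Gk H4 Lh Lh'.
    pose proof (sqeq_heads _ _ _ _ H1); subst y'.
    apply (lift_El _ _ _ _ (sqeq_sym _ _ H3)) in Lh. apply (lift_El _ _ _ _ (sqeq_sym _ _ H4)) in Lh'.
    pose proof (flat_reduced _ _ _ _ _ G H1 H2 Ayz) as Gg.
    destruct (up_not_lower _ _ _ _ _ Gk H1) as [N1 N2].
    pose proof (lower_adj _ _ _ _ G H1) as Ayx.
    assert (Nxq : x <> q) by (intros ->; auto).
    assert (Axq : ~ adj x q). { intros C. destruct (Hdia y q x z); auto. }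
    destruct (edge_apex x q z' z y) as (m & M1 & M2 & M3); auto.
    assert (L : lift (z' :: y :: l) q (q :: m :: x :: u)).
    { eapply lift_flat with (y := z') (x := m); [| | |apply sqeq_refl]; auto.
      eapply sqeq_trans; [apply sqeq_cons; exact H1|]. apply sqeq_alt; auto. }
    assert (K : sqeq (q :: m :: x :: u) (q :: z :: x :: u)) by (apply sqeq_alt; auto).
    apply sqeq_trans with (q :: m :: x :: u); [|eapply lift_unique; [exact Gk|exact L|exact Lh']].
    eapply lift_unique; [exact Gg|exact Lh|].
    apply lift_up; [|apply sqeq_sym; auto]. eapply reduced_sqeq; [|exact K]. eapply lift_good; [|exact L]. auto. }
  destruct Lg as [y1 u H1 H2|y1 x u H1 H2 H3 H4|H1 H2];
  destruct Lk as [y2 u' H1' H2'|y2 x' u' H1' H2' H3' H4'|H1' H2'];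
  try (exfalso; apply sqeq_length in H1; apply sqeq_length in H2; simpl in *; lia);
  try (exfalso; apply sqeq_length in H1'; apply sqeq_length in H2'; simpl in *; lia).
  - destruct (lowers _ _ _ _ _ _ _ G H1 H1') as [<- [[-> _]|(N & N' & t & s & K1 & K2 & A1 & A2 & A3 & A4 & A5 & A6)]].
    { pose proof (lower_adj _ _ _ _ G H1'). pose proof (sqeq_heads _ _ _ _ H1); subst y1.
      destruct (Hdia z z' x' y); auto; tauto. }
    pose proof (sqeq_heads _ _ _ _ H1); subst y1.
    assert (J1 : sqeq (z :: x :: t :: s) g) by (eapply sqeq_trans; [apply sqeq_cons, sqeq_sym; exact K1|exact H4]).
    assert (J2 : sqeq (z' :: x' :: t :: s) k) by (eapply sqeq_trans; [apply sqeq_cons, sqeq_sym; exact K2|exact H4']).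
    pose proof (reduced_sqeq _ _ Gg (sqeq_sym _ _ J1)) as G1. pose proof (reduced_sqeq _ _ Gk (sqeq_sym _ _ J2)) as G2.
    destruct (reduced3 _ _ _ _ G1) as (B1 & B2 & B3 & B4).
    destruct (reduced3 _ _ _ _ G2) as (C1 & C2 & C3 & C4).
    assert (Ln : n = 3 + length s).
    { rewrite <- Hn, (sqeq_length _ _ H1). simpl. apply sqeq_length in K1. simpl in K1. lia. }
    assert (Nqt : q <> t) by (intros ->; auto).
    assert (Aqt : ~ adj q t).
    { intros A. assert (D : lift g q (q :: t :: s)).
      { eapply lift_down with (y := z); [|apply sqeq_refl].
        eapply sqeq_trans; [apply sqeq_sym; exact J1|]. apply sqeq_alt; auto. }
      pose proof (sqeq_length _ _ (lift_unique _ _ _ _ Gg Lh D)). simpl in *. lia. }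
    (* Both edges are flat. If [q] is at distance 2 from [t], it is level with [z] and [z']. If not,
       (LQC) gives a common vertex [m] below [z] and [z'], and the square read from [m] starts one
       level lower. *)
    destruct (classic (exists m, adj q m /\ adj m t)) as [(m0 & M1 & M2)|N3].
    + destruct (edge_apex t q z m0 x) as (m & D1 & D2 & D3); auto.
      destruct (edge_apex t q z' m0 x') as (m' & D1' & D2' & D3'); auto.
      apply sqeq_trans with (q :: m :: t :: s); [|apply sqeq_trans with (q :: m' :: t :: s)].
      * eapply lift_unique; [exact Gg|exact Lh|].
        eapply lift_flat with (y := z) (x := m); [| | |apply sqeq_refl]; auto.
        eapply sqeq_trans; [apply sqeq_sym; exact J1|]. apply sqeq_alt; auto.
      * apply sqeq_alt; auto.
      * eapply lift_unique; [exact Gk| |exact Lh'].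
        eapply lift_flat with (y := z') (x := m'); [| | |apply sqeq_refl]; auto.
        eapply sqeq_trans; [apply sqeq_sym; exact J2|]. apply sqeq_alt; auto.
    + destruct (square_apex t z z' q x x') as (m & D1 & D2 & D3); auto.
      { intros m E1 E2. apply N3. exists m; auto. }
      assert (Q1 : sqeq (z :: m :: t :: s) g).
      { eapply sqeq_trans; [|exact J1]. apply sqeq_alt; auto. }
      assert (Q2 : sqeq (z' :: m :: t :: s) k).
      { eapply sqeq_trans; [|exact J2]. apply sqeq_alt; auto. }
      pose proof (reduced_sqeq _ _ Gg (sqeq_sym _ _ Q1)) as F1.
      pose proof (reduced_sqeq _ _ Gk (sqeq_sym _ _ Q2)) as F2.
      assert (Hlt : length (m :: t :: s) < n) by (simpl; lia).
      apply (IH _ Hlt m (t :: s) z q z' g k); auto.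
      * eapply reduced_tail; [exact F1|discriminate].
      * apply lift_up; auto.
      * apply lift_up; auto.
      * intros ->; auto.
      * intros A; eauto.
  - apply (FU z z' g k h h' y1 x u); auto.
  - apply sqeq_sym. apply (FU z' z k g h' h y2 x' u'); auto.
  - apply (lift_El _ _ _ _ (sqeq_sym _ _ H2)) in Lh. apply (lift_El _ _ _ _ (sqeq_sym _ _ H2')) in Lh'.
    destruct (UU z z' h h') as [|K]; auto.
    destruct (UU z' z h' h) as [|K']; auto using sqeq_sym.
    eapply sqeq_trans; [apply sqeq_sym; exact K|]. eapply sqeq_trans; [|exact K'].
    apply sqeq_swap. constructor; auto.
Qed.

(** * Lifting walks to the cover *)

Section Track.
Context (b : V).

(** Path lifting from the base [b], the last entry. It is a relation because lifts are determined
    only up to [sqeq]. *)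
Inductive track : list V -> list V -> Prop :=
| track_base : track [b] [b]
| track_step z l g g' : track l g -> lift g z g' -> track (z :: l) g'.

Lemma track_inv x l g : track (x :: l) g ->
  exists g0, g = x :: g0 /\ reduced g /\ last g b = b /\ length g <= S (length l) /\
    is_walk_seq adj x l /\ last (x :: l) b = b.
Proof.
  revert x g; induction l as [|y l IH]; intros x g H; inversion H; subst.
  - exists []. repeat split; simpl; auto. constructor.
  - inversion H2.
  - destruct (IH _ _ H2) as (g1 & -> & G & L & N & W & A).
    destruct (lift_head _ _ _ H4) as [g2 ->]. exists g2. repeat split; auto.
    + eapply lift_good; eauto.
    + rewrite (lift_last _ _ _ _ b H4); auto.
    + pose proof (lift_length _ _ _ H4). simpl in *; lia.
    + apply Hsym. eapply lift_adj; eauto.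
Qed.

Lemma track_ex x l : is_walk_seq adj x l -> last (x :: l) b = b -> exists g, track (x :: l) g.
Proof.
  revert x; induction l as [|y l IH]; intros x W L.
  - simpl in L; subst. exists [b]; constructor.
  - destruct W as [A W]. destruct (IH y W L) as [g T].
    destruct (track_inv _ _ _ T) as (g0 & -> & G & _).
    destruct (lift_ex y g0 x G (Hsym _ _ A)) as [h Lh]. exists h. econstructor; eauto.
Qed.

Lemma track_E l g g' : track l g -> sqeq g g' -> track l g'.
Proof.
  intros [|z k g0 g1 T Lf] H.
  - rewrite (sqeq_one _ _ H). constructor.
  - econstructor; eauto. eapply lift_Er; eauto.
Qed.

Lemma track_good x l : reduced (x :: l) -> last (x :: l) b = b -> track (x :: l) (x :: l).
Proof.
  revert x; induction l as [|y l IH]; intros x G L.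
  - simpl in L; subst; constructor.
  - econstructor; [apply IH|]; auto.
    + eapply reduced_tail; eauto; discriminate.
    + apply lift_up; auto; constructor.
Qed.

Lemma track_tail z y l g : track (z :: y :: l) g ->
  exists g0, track (y :: l) (y :: g0) /\ reduced (y :: g0) /\ lift (y :: g0) z g.
Proof.
  intros H. inversion H; subst. destruct (track_inv _ _ _ H2) as (g1 & -> & G & _). eauto.
Qed.

Lemma track_app x m x' m' : (forall g, track (x :: m) g <-> track (x' :: m') g) ->
  forall p g, track (p ++ x :: m) g <-> track (p ++ x' :: m') g.
Proof.
  assert (K : forall z p y q g, track (z :: p ++ y :: q) g ->
    exists g0, track (p ++ y :: q) g0 /\ lift g0 z g).
  { intros z p y q g T. inversion T; subst; eauto. destruct p; discriminate. }
  intros H. induction p as [|a p IH]; simpl; auto.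
  intros g; split; intros T; destruct (K _ _ _ _ _ T) as (g0 & T' & L);
    econstructor; eauto; apply IH; auto.
Qed.

Lemma track_back x y q g : adj x y -> track (x :: y :: x :: q) g <-> track (x :: q) g.
Proof.
  intros A; split; intros T.
  - destruct (track_tail _ _ _ _ T) as (g1 & T1 & G1 & L1).
    destruct (track_tail _ _ _ _ T1) as (g2 & T2 & G2 & L2).
    eapply track_E; [exact T2|]. eapply lift_unique; [exact G1| |exact L1].
    eapply lift_back; eauto.
  - destruct (track_inv _ _ _ T) as (g1 & -> & G & _).
    destruct (lift_ex x g1 y G A) as [h L]. destruct (lift_head _ _ _ L) as [h0 ->].
    econstructor; [econstructor; eauto|]. eapply lift_back; eauto.
Qed.

Lemma track_triangle x y z q g : adj x y -> adj y z -> adj z x ->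
  track (x :: y :: z :: q) g <-> track (x :: z :: q) g.
Proof.
  intros A B C; split; intros T.
  - destruct (track_tail _ _ _ _ T) as (g1 & T1 & G1 & L1).
    destruct (track_tail _ _ _ _ T1) as (g2 & T2 & G2 & L2).
    econstructor; [exact T2|]. destruct (lift_ex z g2 x G2 C) as [k K].
    eapply lift_Er; [|exact K]. eapply lift_unique; [exact G1| |exact L1].
    apply (lift_triangle z g2 y x); auto.
  - destruct (track_tail _ _ _ _ T) as (g1 & T1 & G1 & L1).
    destruct (lift_ex z g1 y G1 (Hsym _ _ B)) as [h L].
    econstructor; [econstructor; eauto|].
    apply (lift_triangle z g1 y x); auto.
Qed.

Lemma track_square x y z w q g : induced_C4 adj x y z w ->
  track (x :: y :: z :: q) g -> track (x :: w :: z :: q) g.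
Proof.
  intros (N1 & N2 & N3 & N4 & N5 & N6 & A1 & A2 & A3 & A4 & A5 & A6) T.
  destruct (track_tail _ _ _ _ T) as (g1 & T1 & G1 & L1).
  destruct (track_tail _ _ _ _ T1) as (g2 & T2 & G2 & L2).
  destruct (lift_ex z g2 w G2 A3) as [h L]. destruct (lift_head _ _ _ L) as [h0 ->].
  destruct (lift_ex w h0 x (lift_good _ _ _ G2 L) A4) as [k K].
  econstructor; [econstructor; eauto|].
  eapply lift_Er; [|exact K]. apply sqeq_sym.
  eapply (lift_square _ z g2 y x w _ _ _ _ eq_refl G2 L2 L L1 K); auto.
Qed.

Lemma induced_C4_sym x y z w : induced_C4 adj x y z w -> induced_C4 adj x w z y.
Proof. unfold induced_C4. intuition auto. Qed.

Lemma track_homotopic l l' : homotopic adj l l' -> forall g, track l g <-> track l' g.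
Proof.
  induction 1 as [l l' H|l|l l' _ IH|l l' l'' _ IH1 _ IH2]; intros g.
  - revert g. destruct H; simpl; apply track_app; intros g.
    + apply track_back; auto.
    + apply track_triangle; auto.
    + split; apply track_square; auto using induced_C4_sym.
  - reflexivity.
  - symmetry; auto.
  - etransitivity; eauto.
Qed.

(** Continue the lift of [v :: l] backwards along [l']. If it ends at [[b]], then reversing these
    edges, by [lift_back] and uniqueness, shows that it was at [v :: l'] before. *)
Lemma track_retrace l' : forall v l g, reduced (v :: l') -> last (v :: l') b = b -> track (v :: l) g ->
  exists g', track (rev l' ++ v :: l) g' /\ (g' = [b] -> sqeq g (v :: l')).
Proof.
  induction l' as [|v2 l' IH]; intros v l g G L T.
  - simpl in L; subst v. exists g. split; auto. intros ->; constructor.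
  - destruct (track_inv _ _ _ T) as (g0 & -> & Gg & _).
    pose proof (reduced_adj _ _ _ G) as A.
    destruct (lift_ex v g0 v2 Gg A) as [g2 L2].
    assert (G' : reduced (v2 :: l')) by (eapply reduced_tail; eauto; discriminate).
    destruct (IH v2 (v :: l) g2) as (g' & T' & U); auto.
    { econstructor; eauto. }
    exists g'. simpl. rewrite <- app_assoc. split; auto. intros Hb.
    assert (K : lift (v2 :: l') v (v :: g0)).
    { eapply lift_El; [exact (U Hb)|]. eapply lift_back; eauto. }
    eapply lift_unique; [exact G'|exact K|]. apply lift_up; auto. constructor.
Qed.

Context (Hsc : forall l, closed_walk adj b l -> homotopic adj (b :: l) [b]).

(** Here simple connectivity enters: the walk followed by the reverse of [l'] is a closed walk at
    [b], null-homotopic, so its lift ends at [[b]]. *)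
Lemma track_reach v l l' g : reduced (v :: l') -> last (v :: l') b = b -> track (v :: l) g -> sqeq g (v :: l').
Proof.
  intros G L T. destruct (track_retrace l' v l g G L T) as (g' & T' & U). apply U.
  assert (H : exists l2, rev l' ++ v :: l = b :: l2).
  { assert (K : rev (v :: l') = b :: rev (removelast (v :: l'))).
    { rewrite (app_removelast_last b (l := v :: l')) at 1 by discriminate.
      rewrite rev_app_distr, L. reflexivity. }
    exists (rev (removelast (v :: l')) ++ l).
    change (rev l' ++ v :: l) with (rev l' ++ [v] ++ l). rewrite app_assoc.
    change (rev l' ++ [v]) with (rev (v :: l')). rewrite K. reflexivity. }
  destruct H as [l2 H]. rewrite H in T'.
  destruct (track_inv _ _ _ T') as (_ & _ & _ & _ & _ & W & L2).
  assert (C : closed_walk adj b l2).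
  { split; auto. destruct l2; auto. }
  apply (track_homotopic _ _ (Hsc _ C)) in T'. inversion T'; auto. inversion H2.
Qed.

Lemma reduced_unique v l l' : reduced (v :: l) -> last (v :: l) b = b ->
  reduced (v :: l') -> last (v :: l') b = b -> sqeq (v :: l) (v :: l').
Proof. intros. eapply track_reach; eauto. apply track_good; auto. Qed.

Lemma walk_list n u v : walk adj n u v ->
  exists l, length l = n /\ is_walk_seq adj u l /\ last (u :: l) v = v.
Proof.
  induction 1 as [u|n u x w A W (l & L1 & L2 & L3)].
  - exists []. repeat split.
  - exists (x :: l). repeat split; simpl; auto.
Qed.

Lemma list_walk l : forall u v, is_walk_seq adj u l -> last (u :: l) v = v -> walk adj (length l) u v.
Proof.
  induction l as [|x l IH]; intros u v W L.
  - simpl in L; subst; constructor.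
  - destruct W as [A W]. econstructor; eauto.
Qed.

(** * Distances and weak modularity from reduced walks *)

(** Lifting never lengthens a walk; applied to a geodesic, whose lift is equivalent to [v :: l],
    this bounds the length of [l]. *)
Lemma reduced_d v l : reduced (v :: l) -> last (v :: l) b = b -> d b v = length l.
Proof.
  intros G L. destruct (track_inv _ _ _ (track_good _ _ G L)) as (_ & _ & _ & _ & _ & W & _).
  rewrite d_sym. apply Nat.le_antisymm.
  - apply d_le. apply list_walk; auto.
  - destruct (walk_list _ _ _ (d_walk v b)) as (k & K1 & K2 & K3).
    destruct (track_ex _ _ K2 K3) as [g T].
    destruct (track_inv _ _ _ T) as (g0 & -> & _ & _ & N & _).
    pose proof (sqeq_length _ _ (track_reach _ _ _ _ G L T)). simpl in *; lia.
Qed.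

Lemma reduced_exists v : exists l, reduced (v :: l) /\ last (v :: l) b = b.
Proof.
  destruct (walk_list _ _ _ (d_walk v b)) as (k & K1 & K2 & K3).
  destruct (track_ex _ _ K2 K3) as [g T]. destruct (track_inv _ _ _ T) as (g0 & -> & G & L & _). eauto.
Qed.

Lemma reduced_lift v l w k : reduced (v :: l) -> last (v :: l) b = b ->
  reduced (w :: k) -> last (w :: k) b = b -> adj v w -> lift (v :: l) w (w :: k).
Proof.
  intros G1 L1 G2 L2 A. destruct (lift_ex v l w G1 A) as [h H].
  eapply lift_Er; [|exact H]. destruct (lift_head _ _ _ H) as [h0 ->].
  apply reduced_unique; auto.
  - exact (lift_good _ _ _ G1 H).
  - exact (eq_trans (lift_last _ _ _ _ b H) L1).
Qed.

Lemma lower_d w v x u : reduced w -> last w b = b -> sqeq w (v :: x :: u) -> d b x = length u.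
Proof.
  intros G L H. apply reduced_d.
  - eapply reduced_tail; [eapply reduced_sqeq; eauto|discriminate].
  - rewrite (sqeq_last _ _ b H) in L. exact L.
Qed.

(** Equal distances make the edge flat, and a flat edge comes with a common neighbour one level
    below. *)
Lemma cover_TC : TC adj b.
Proof.
  intros v w Hvw Hv Hd. apply d_one in Hvw.
  destruct (reduced_exists v) as (l & G1 & L1). destruct (reduced_exists w) as (k & G2 & L2).
  rewrite (reduced_d _ _ G1 L1), (reduced_d _ _ G2 L2) in *.
  destruct (reduced_lift v l w k G1 L1 G2 L2 Hvw) as [y u H1 H2|y x u H1 H2 H3 H4|H1 H2].
  - apply sqeq_length in H1; apply sqeq_length in H2; simpl in *; lia.
  - pose proof (lower_adj _ _ _ _ G1 H1). pose proof (sqeq_heads _ _ _ _ H1); subst y.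
    exists x. repeat split; auto. rewrite (lower_d _ _ _ _ G1 L1 H1).
    apply sqeq_length in H1; simpl in *; lia.
  - apply sqeq_length in H2; simpl in *; lia.
Qed.

(** Both [v] and [w] can follow [z] in a reduced walk, so [lowers] gives the fourth corner [t]. *)
Lemma cover_QC : QC adj b.
Proof.
  intros v w z Hvz Hwz Hvw H2 Hd Hz. apply d_one in Hvz, Hwz.
  destruct (reduced_exists v) as (l & G1 & L1). destruct (reduced_exists w) as (k & G2 & L2).
  destruct (reduced_exists z) as (m & G3 & L3).
  rewrite (reduced_d _ _ G1 L1), (reduced_d _ _ G2 L2), (reduced_d _ _ G3 L3) in *.
  assert (K : forall v l, reduced (v :: l) -> last (v :: l) b = b -> adj v z -> length m = S (length l) ->
    sqeq (z :: m) (z :: v :: l)).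
  { intros a e G L A N. destruct (reduced_lift a e z m G L G3 L3 A) as [y u J1 J2|y x u J1 _ _ J2|J1 J2];
      [apply sqeq_length in J1; apply sqeq_length in J2; simpl in *; lia ..|]. apply sqeq_sym; auto. }
  assert (K1 : sqeq (z :: m) (z :: v :: l)) by (apply K; auto; lia).
  assert (K2 : sqeq (z :: m) (z :: w :: k)) by (apply K; auto; lia).
  destruct (lowers _ _ _ _ _ _ _ G3 K1 K2) as [_ [[-> _]|(_ & _ & t & s & J1 & _ & _ & _ & J3 & J4 & _)]].
  { rewrite d_refl in Hvw. lia. }
  exists t. repeat split; auto. rewrite (lower_d _ _ _ _ G1 L1 J1).
  apply sqeq_length in J1. simpl in *; lia.
Qed.
End Track.
End Cover.

(** * Simple connectivity *)

Section SimplyConnected.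
Hypothesis WM : weakly_modular adj.
Context (b : V).

Definition geo (v : V) (l : list V) : Prop :=
  is_walk_seq adj v l /\ last (v :: l) b = b /\ length l = d b v.

Lemma homotopic_cons a l l' : homotopic adj l l' -> homotopic adj (a :: l) (a :: l').
Proof.
  induction 1 as [l l' H|l|l l' _ IH|l l' l'' _ IH1 _ IH2].
  - apply rst_step. destruct H.
    + apply (ht_back adj (a :: p)); auto.
    + apply (ht_tri adj (a :: p)); auto.
    + apply (ht_sq adj (a :: p)); auto.
  - apply rst_refl.
  - apply rst_sym; auto.
  - eapply rst_trans; eauto.
Qed.

Lemma homotopic_back x y q : adj x y -> homotopic adj (x :: y :: x :: q) (x :: q).
Proof. intros A. apply rst_step. apply (ht_back adj [] q x y A). Qed.

Lemma homotopic_triangle x y z q : adj x y -> adj y z -> adj z x ->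
  homotopic adj (x :: y :: z :: q) (x :: z :: q).
Proof. intros A B C. apply rst_step. apply (ht_tri adj [] q x y z A B C). Qed.

Lemma geo_ex v : exists l, geo v l.
Proof.
  destruct (walk_list _ _ _ (d_walk v b)) as (l & L1 & L2 & L3).
  exists l. repeat split; auto. rewrite d_sym; auto.
Qed.

Lemma geo_cons v y l : geo y l -> adj v y -> d b v = S (d b y) -> geo v (y :: l).
Proof. intros (W & L & N) A D. repeat split; simpl; auto; lia. Qed.

Lemma geo_inv v y l : geo v (y :: l) -> adj v y /\ geo y l /\ d b v = S (d b y).
Proof.
  intros ([A W] & L & N). simpl in N.
  assert (H : d b y <= length l) by (rewrite d_sym; apply d_le, list_walk; auto).
  pose proof (d_adj_bounds b v y A). repeat split; auto; lia.
Qed.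

(** (TC) extended to level 1, where [b] itself is the vertex sought. *)
Lemma lower_of_edge v w k : adj v w -> d b v = S k -> d b w = S k ->
  exists x, adj x v /\ adj x w /\ d b x = k.
Proof.
  intros A Dv Dw. destruct k as [|k].
  - apply d_one in Dv, Dw. exists b. repeat split; auto. apply d_refl.
  - destruct (proj1 (WM b) v w) as (x & X1 & X2 & X3); try lia; [apply d_adj; auto|].
    exists x. repeat split; auto; lia.
Qed.

Lemma lower_of_square v w z k : adj v z -> adj w z -> far2 v w -> d b v = S k -> d b w = S k ->
  d b z = S (S k) -> exists x, adj x v /\ adj x w /\ d b x = k.
Proof.
  intros A B F Dv Dw Dz. destruct k as [|k].
  - apply d_one in Dv, Dw. exists b. repeat split; auto. apply d_refl.
  - destruct (proj2 (WM b) v w z) as (x & X1 & X2 & X3); try lia; try (apply d_adj; auto).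
    + apply d_two; auto.
    + exists x. repeat split; auto; lia.
Qed.

(** The first vertices [y1] and [y2] have a common neighbour [x] one step nearer to [b]; detour
    through [x] by induction and fill the remaining triangles or square. *)
Lemma geo_homotopic l : forall v l', geo v l -> geo v l' -> homotopic adj (v :: l) (v :: l').
Proof.
  assert (Main : forall n l, length l = n -> forall v l', geo v l -> geo v l' -> homotopic adj (v :: l) (v :: l')).
  { clear l. induction n as [|n IH]; intros l Hl v l' G G'.
    - destruct l; [|discriminate]. pose proof G as (_ & _ & N). pose proof G' as (_ & _ & N').
      simpl in N. destruct l'; [apply rst_refl|simpl in N'; lia].
    - destruct l as [|y1 l1]; [discriminate|]. injection Hl as Hl.
      pose proof G' as (_ & _ & N'). pose proof G as (_ & _ & N).
      destruct l' as [|y2 l2]; [simpl in *; lia|].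
      destruct (geo_inv _ _ _ G) as (A1 & G1 & D1). destruct (geo_inv _ _ _ G') as (A2 & G2 & D2).
      simpl in N, N'.
      destruct (classic (y1 = y2)) as [->|Ny]; [apply homotopic_cons; auto|].
      assert (Dy1 : d b y1 = n) by lia. assert (Dy2 : d b y2 = n) by lia.
      destruct n as [|k].
      { apply d_zero in Dy1, Dy2. congruence. }
      assert (X : exists x, adj x y1 /\ adj x y2 /\ d b x = k).
      { destruct (classic (adj y1 y2)) as [A|A]; [apply lower_of_edge; auto|].
        apply (lower_of_square y1 y2 v); auto; [|lia]. repeat split; auto. exists v; auto. }
      destruct X as (x & X1 & X2 & X3). destruct (geo_ex x) as [m Gm].
      assert (K1 : geo y1 (x :: m)) by (apply geo_cons; auto; lia).
      assert (K2 : geo y2 (x :: m)) by (apply geo_cons; auto; lia).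
      assert (L2 : length (x :: m) = S k) by (destruct K1 as (_ & _ & Z); lia).
      eapply rst_trans; [apply homotopic_cons, (IH l1 Hl y1 (x :: m)); auto|].
      eapply rst_trans; [|apply homotopic_cons, (IH (x :: m) L2 y2 l2); auto].
      destruct (classic (adj y1 y2)) as [A|A].
      + eapply rst_trans; [apply rst_sym, homotopic_cons, (homotopic_triangle y1 y2 x); auto|].
        apply homotopic_triangle; auto.
      + apply rst_step. apply (ht_sq adj [] m v y1 x y2).
        assert (Nvx : v <> x) by (intros ->; lia).
        assert (Avx : ~ adj v x).
        { intros B. pose proof (d_adj_bounds b v x B). lia. }
        assert (X : forall p q, adj p q -> p <> q) by (intros p q B ->; exact (Hirr _ B)).
        repeat split; auto. }
  intros. apply (Main (length l)); auto.
Qed.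

(** Prepending a vertex to a geodesic is repaired by first moving the geodesic through a suitable
    vertex: [v] itself if [v] is nearer to [b], a common lower neighbour if level. *)
Lemma homotopic_geo l : forall v, is_walk_seq adj v l -> last (v :: l) b = b ->
  exists l', geo v l' /\ homotopic adj (v :: l) (v :: l').
Proof.
  induction l as [|y l IH]; intros v W L.
  - simpl in L; subst v. exists []. split; [|apply rst_refl]. repeat split; simpl; auto.
    rewrite d_refl; auto.
  - destruct W as [A W]. destruct (IH y W L) as (l1 & G & H).
    apply (homotopic_cons v) in H. pose proof (d_adj_bounds b v y A).
    destruct (lt_eq_lt_dec (d b v) (d b y)) as [[Hlt|Heq]|Hgt].
    + destruct (geo_ex v) as [m Gm]. exists m. split; auto.
      eapply rst_trans; [exact H|].
      eapply rst_trans; [apply homotopic_cons, (geo_homotopic l1 y (v :: m)); auto|].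
      * apply geo_cons; auto; lia.
      * apply homotopic_back; auto.
    + destruct (d b y) as [|k] eqn:Dy.
      { apply d_zero in Dy, Heq. subst. destruct (Hirr _ A). }
      destruct (lower_of_edge v y k A Heq Dy) as (x & X1 & X2 & X3).
      destruct (geo_ex x) as [m Gm]. exists (x :: m). split; [apply geo_cons; auto; lia|].
      eapply rst_trans; [exact H|].
      eapply rst_trans; [apply homotopic_cons, (geo_homotopic l1 y (x :: m)); auto|].
      * apply geo_cons; auto; lia.
      * apply homotopic_triangle; auto.
    + exists (y :: l1). split; auto. apply geo_cons; auto; lia.
Qed.

Lemma closed_walk_null l : closed_walk adj b l -> homotopic adj (b :: l) [b].
Proof.
  intros [W L]. destruct (homotopic_geo l b W) as (l' & (_ & _ & N) & H).
  - destruct l; auto.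
  - rewrite d_refl in N. destruct l'; [auto|discriminate].
Qed.
End SimplyConnected.

(** * The two equivalences *)

Lemma weakly_modular_LQC : weakly_modular adj -> forall u, LQC adj u.
Proof.
  intros WM u v w z A B Dvw Dv Dw Dz.
  destruct (proj2 (WM u) v w z) as (x & X1 & X2 & X3); try lia; try (apply d_adj; auto).
  exists x. repeat split; auto. apply Hsym, d_one; lia.
Qed.

Lemma dual_polar_iff_weakly_modular : dual_polar adj <->
  (thick adj /\ weakly_modular adj /\ ~ has_induced_K4minus adj /\ ~ has_isometric_K33minus adj).
Proof.
  rewrite <- diamond_free_iff. split.
  - intros (H1 & H34 & H5). repeat split.
    + apply A5_thick; auto.
    + exact (A1_TC H1 u).
    + exact (A34_QC H34 u).
    + apply A1_diamond_free; auto.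
    + apply A34_no_K33minus; auto.
  - intros (Ht & WM & Hdia & HK).
    assert (HA : A34 adj) by (apply weakly_modular_A34; auto).
    split; [apply weakly_modular_A1|split; [|apply A34_A5]]; auto.
Qed.

Lemma weakly_modular_iff_local : diamond_free ->
  weakly_modular adj <-> locally_weakly_modular adj /\ tri_sq_simply_connected adj.
Proof.
  intros Hdia. split.
  - intros WM. split; [|split; auto; intros; apply closed_walk_null; auto].
    intros u. split; [|apply weakly_modular_LQC; auto].
    apply LTC_triangle_local, TC_triangle_local. exact (fun u => proj1 (WM u)).
  - intros [HL [_ Hsc]].
    assert (Htri : triangle_local) by exact (proj1 LTC_triangle_local (fun u => proj1 (HL u))).
    assert (HQ : forall u, LQC adj u) by exact (fun u => proj2 (HL u)).
    intros u. split; [apply cover_TC|apply cover_QC]; auto.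
Qed.
End Graph.

Theorem theorem5p2 (V : Type) (adj : V -> V -> Prop)
  (Hsym : forall x y, adj x y -> adj y x)
  (Hirr : forall x, ~ adj x x)
  (Hconn : connected adj) :
  (dual_polar adj <->
     (thick adj /\ weakly_modular adj /\ ~ has_induced_K4minus adj /\
      ~ has_isometric_K33minus adj)) /\
  (dual_polar adj <->
     (thick adj /\ locally_weakly_modular adj /\ ~ has_induced_K4minus adj /\
      ~ has_isometric_K33minus adj /\ tri_sq_simply_connected adj)).
Proof.
  pose proof (dual_polar_iff_weakly_modular Hsym Hirr Hconn) as H.
  pose proof (weakly_modular_iff_local Hsym Hirr Hconn) as HL.
  rewrite (diamond_free_iff Hsym Hirr) in HL. tauto.
Qed.
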